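(* Let $N$ and $k$ be integers with $1\le k<N/2$. There is a quantum query algorithm which, given $N$ and $k$ and oracle access to the balance oracle $O_{B,x}$ for an unknown $x\in\{0,1\}^N$ with Hamming weight $wt(x)=k$, outputs $x$ (i.e., identifies all $k$ false coins) with probability $1$, using $O(k^{1/4})$ queries. The constant in the $O(\cdot)$ is absolute; in particular the bound does not depend on $N$.
   Context: Counterfeit coin model: there are $N$ coins, described by an unknown string $x=x_1\cdots x_N\in\{0,1\}^N$, where $x_i=1$ means coin $i$ is false and $x_i=0$ that it is fair; the number $k=wt(x)$ of false coins is known in advance, and it is assumed throughout that $k<N/2$. For $0\le l\le\lfloor N/2\rfloor$ let $Q_l$ be the set of strings $q\in\{0,1,-1\}^N$ having exactly $l$ entries equal to $1$ and exactly $l$ entries equal to $-1$, and let $Q^{(B)}=\bigcup_{l=0}^{\lfloor N/2\rfloor}Q_l$ (entry $1$/$-1$ means coin $i$ is put on the left/right pan, $0$ means it is not weighed). For $q\in Q^{(B)}$ let $\chi(x;q)=0$ if $\sum_i q_ix_i=0$ (scale balanced) and $\chi(x;q)=1$ otherwise (scale tilted). The balance oracle (B-oracle) is the unitary $O_{B,x}$ acting on the query register by $O_{B,x}|q\rangle=(-1)^{\chi(x;q)}|q\rangle$ for $q\in Q^{(B)}$; the algorithm may use arbitrary query-independent unitaries and workspace between queries. Query complexity is the number of applications of the oracle. *)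

(* Defs.v *)
From mathcomp Require Import all_boot all_order all_algebra.
From mathcomp Require Import complex Rstruct.
Set Implicit Arguments. Unset Strict Implicit. Unset Printing Implicit Defensive.
Import Order.TTheory GRing.Theory Num.Theory.
Local Open Scope ring_scope.

Definition C : numClosedFieldType := Rdefinitions.R[i].

(* Entries of a query string: 0 |-> 0 (not weighed), 1 |-> 1 (left pan),
   2 |-> -1 (right pan). *)
Definition qval (a : 'I_3) : int :=
  if val a == 1%N then 1 else if val a == 2%N then -1 else 0.

(* q lies in Q^(B) = union of Q_l : as many 1's as -1's
   (then automatically l <= floor(N/2)). *)
Definition is_Bquery N (q : {ffun 'I_N -> 'I_3}) : bool :=
  #|[pred i | val (q i) == 1%N]| == #|[pred i | val (q i) == 2%N]|.

Definition QB (N : nat) := {q : {ffun 'I_N -> 'I_3} | is_Bquery q}.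

Definition chi N (x : {ffun 'I_N -> bool}) (q : QB N) : bool :=
  (\sum_(i < N) qval (sval q i) * (x i : nat)%:Z) != 0.

Definition wt N (x : {ffun 'I_N -> bool}) : nat := #|[pred i | x i]|.

Definition unitary (S : finType) (U : S -> S -> C) : Prop :=
  forall s t : S, \sum_(r : S) (U r s)^* * U r t = (s == t)%:R.

Definition apply (S : finType) (U : S -> S -> C) (v : S -> C) : S -> C :=
  fun s => \sum_(t : S) U s t * v t.

Definition basis_vec (S : finType) (s0 : S) : S -> C := fun s => (s == s0)%:R.

Definition oracle {N : nat} {W : finType} (x : {ffun 'I_N -> bool})
  (v : QB N * W -> C) : QB N * W -> C :=
  fun s => (-1) ^+ chi x s.1 * v s.

(* A quantum query algorithm with [nqueries] queries: state space spanned by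
   |q,w>, q in Q^(B), w in a finite workspace basis [wsp]; start in a basis
   state [init]; apply gate 0, then (oracle, gate i) for i = 1..nqueries;
   measure in the computational basis and output [output s]. *)
Record qalg (N : nat) := QAlg {
  wsp : finType;
  nqueries : nat;
  init : (QB N * wsp)%type;
  gate : nat -> (QB N * wsp)%type -> (QB N * wsp)%type -> C;
  gate_unitary : forall i, (i <= nqueries)%N -> unitary (gate i);
  output : (QB N * wsp)%type -> {ffun 'I_N -> bool} }.
Arguments wsp {N}. Arguments nqueries {N}. Arguments init {N}.
Arguments gate {N}. Arguments gate_unitary {N}. Arguments output {N}.

Fixpoint state N (A : qalg N) (x : {ffun 'I_N -> bool}) (i : nat)
  : (QB N * wsp A)%type -> C :=
  match i with
  | 0 => apply (gate A 0) (basis_vec (init A))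
  | i'.+1 => apply (gate A i'.+1) (@oracle N (wsp A) x (@state N A x i'))
  end.
Arguments state {N} A x i.

Definition final_state N (A : qalg N) (x : {ffun 'I_N -> bool}) :=
  state A x (nqueries A).
Arguments final_state {N} A x.

Definition prob_output {N : nat} (A : qalg N) (x y : {ffun 'I_N -> bool}) : C :=
  \sum_(s | output A s == y) `|final_state A x s| ^+ 2.

(* Main.v *)
Require Import Defs.
From mathcomp Require Import all_boot all_order all_algebra.
From mathcomp Require Import ring lra zify.
From Stdlib Require Import FunctionalExtensionality.
Set Implicit Arguments. Unset Strict Implicit. Unset Printing Implicit Defensive.
Import Order.TTheory GRing.Theory Num.Theory.
Local Open Scope ring_scope.

(* A balance query can be balanced on a set [S] of coins put on the pans only if
   [S] contains an even number of false coins; if it does and [S] is split at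
   random, balance has probability at least of order [k^(-1/2)].  Grover rotation
   inside each class of splits then tells the two cases apart after [t = O(k^(1/4))]
   queries: the amplitude is a Chebyshev polynomial of degree [t] in the bias, and
   averaging over [t] shows that some [t] computes the parity of [S] well enough
   for Fourier sampling (Bernstein-Vazirani) to return [x] with constant amplitude.
   This amplitude depends only on [N] and [k].

   Errors are made detectable as follows.  Match the [k] supposedly false coins
   with [k] supposedly fair ones and weigh random orientations of a subset of the
   pairs.  A pair of equal coins contributes nothing, so the Fourier amplitude of
   the full set of pairs vanishes exactly unless all pairs are unlike, and is a
   known constant if the candidate is right.  Two shifted matchings of the
   candidate with [k + 1] supposedly fair coins both pass only if it is right,
   because there are only [k] false coins.

   So exactly one outcome, the correct one, has nonzero amplitude, and that
   amplitude is known: amplitude amplification becomes exact. *)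

(** * Unitary maps on functions *)

Section Vectors.
Variables (K : numClosedFieldType) (S : finType).
Implicit Types (u v w : S -> K) (f g : (S -> K) -> S -> K).

Definition ket (e : S) : S -> K := fun s => (s == e)%:R.

Definition ip v w : K := \sum_s (v s)^* * w s.

Lemma ipC v w : (ip v w)^* = ip w v.
Proof.
by rewrite rmorph_sum; apply: eq_bigr => s _; rewrite rmorphM /= conjCK mulrC.
Qed.

Lemma ip_lin u a v w : ip u (fun s => a * v s + w s) = a * ip u v + ip u w.
Proof.
rewrite mulr_sumr -big_split; apply: eq_bigr => s _ /=.
by rewrite mulrDr mulrCA.
Qed.

Lemma ipZ u a v : ip u (fun s => a * v s) = a * ip u v.
Proof. by rewrite mulr_sumr; apply: eq_bigr => s _ /=; rewrite mulrCA. Qed.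

Lemma ipZl u a v : ip (fun s => a * u s) v = a^* * ip u v.
Proof. by rewrite -ipC ipZ rmorphM /= ipC. Qed.

Lemma ip_ketl s v : ip (ket s) v = v s.
Proof.
rewrite /ip (bigD1 s) //= /ket eqxx conjC1 mul1r big1 ?addr0 // => t /negPf ->.
by rewrite conjC0 mul0r.
Qed.

Lemma ip_ketr s v : ip v (ket s) = (v s)^*.
Proof. by rewrite -ipC ip_ketl. Qed.

Lemma ip_norm v : ip v v = \sum_s `|v s| ^+ 2.
Proof. by apply: eq_bigr => s _; rewrite normCK mulrC. Qed.

Lemma ip_real v : (ip v v)^* = ip v v. Proof. exact: ipC. Qed.

Definition lin f := forall a v w,
  f (fun s => a * v s + w s) = (fun s => a * f v s + f w s).

Lemma linZ f a v : lin f -> f (fun s => a * v s) = (fun s => a * f v s).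
Proof.
move=> fL; have f0 : f (fun _ => 0) = fun _ => 0.
  have := fL (-1) (fun _ => 0) (fun _ => 0).
  rewrite mulr0 addr0 => ->; apply: functional_extensionality => s.
  by rewrite mulN1r addNr.
have := fL a v (fun _ => 0); rewrite f0.
have -> : (fun s => a * v s + 0) = (fun s => a * v s).
  by apply: functional_extensionality => s; rewrite addr0.
by move=> ->; apply: functional_extensionality => s; rewrite addr0.
Qed.

(** The inverse [g] is carried along: it supplies adjoints and, later, reversed circuits. *)
Definition unit_map f g := [/\ lin f, forall v w, ip (f v) (f w) = ip v w,
  cancel f g & cancel g f].

Lemma unit_map_sym f g : unit_map f g -> unit_map g f.
Proof.
case=> fL fI fK gK; split=> // [a v w|v w]; last by rewrite -fI !gK.
by apply: (can_inj fK); rewrite gK fL !gK.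
Qed.

Lemma unit_map_comp f f' g g' :
  unit_map f f' -> unit_map g g' -> unit_map (g \o f) (f' \o g').
Proof.
move=> [fL fI fK gK] [fL' fI' fK' gK']; split.
- by move=> a v w /=; rewrite fL fL'.
- by move=> v w /=; rewrite fI' fI.
- exact: can_comp.
- exact: can_comp.
Qed.

Lemma unit_map_id : unit_map id id. Proof. by []. Qed.

Lemma unit_map_selfadj f : lin f -> (forall v w, ip (f v) w = ip v (f w)) ->
  involutive f -> unit_map f f.
Proof. by move=> fL fA fK; split=> // v w; rewrite fA fK. Qed.

Lemma unit_map_adj f g v w : unit_map f g -> ip v (g w) = ip (f v) w.
Proof. by case=> _ fI _ gK; rewrite -fI gK. Qed.

Definition refl u v : S -> K := fun s => 2 * ip u v / ip u u * u s - v s.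

Lemma ip_eq0 u : ip u u = 0 -> u = fun _ => 0.
Proof.
rewrite ip_norm => /eqP; rewrite psumr_eq0 => [/allP u0|s _]; last exact: exprn_ge0.
apply: functional_extensionality => s.
by have /implyP/(_ isT) := u0 s (mem_index_enum _); rewrite sqrf_eq0 normr_eq0 => /eqP.
Qed.

Lemma refl_lin u : lin (refl u).
Proof.
move=> a v w; apply: functional_extensionality => s.
rewrite /refl ip_lin; ring.
Qed.

Lemma reflE u v : refl u v = (fun s => 2 * ip u v / ip u u * u s + (-1) * v s).
Proof. by apply: functional_extensionality => s; rewrite mulN1r. Qed.

Lemma ip_refl u v w : ip w (refl u v) = 2 * ip u v / ip u u * ip w u - ip w v.
Proof. 
rewrite reflE ip_lin; congr (_ + _).
by rewrite ipZ mulN1r.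
Qed.

Lemma refl_self u : refl u u = u.
Proof.
apply: functional_extensionality => s; rewrite /refl.
have [/ip_eq0 ->|u0] := eqVneq (ip u u) 0; first by rewrite mulr0 subr0.
by rewrite mulfK //; ring.
Qed.

(** For [u = 0] division by zero makes [refl u] minus the identity, which is still unitary. *)
Lemma refl_unit u : unit_map (refl u) (refl u).
Proof.
apply: unit_map_selfadj; first exact: refl_lin.
- move=> v w; rewrite -ipC !ip_refl rmorphB /= ipC; congr (_ - _).
  rewrite 3!rmorphM /= fmorphV /= ip_real !ipC conjC_nat; ring.
- move=> v; apply: functional_extensionality => s.
  rewrite {1}/refl ip_refl.
  have [u0|u0] := eqVneq (ip u u) 0.
    by rewrite /refl u0 invr0 !mulr0 !mul0r !sub0r opprK.
  rewrite mulfVK // /refl; ring.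
Qed.

(* Householder: the reflection in the bisector of [e] and [u / c] exchanges them. *)
Lemma refl_prep (e : S) u (c : K) : 0 < c -> ip u u = c ^+ 2 -> 0 <= u e ->
  refl (fun s => c * ket e s + u s) (ket e) = (fun s => c^-1 * u s).
Proof.
move=> c0 uc ue; apply: functional_extensionality => s.
have c' : c^* = c by apply: CrealP; exact: ger0_real (ltW c0).
have ue' : (u e)^* = u e by apply: CrealP; exact: ger0_real ue.
set w := (fun _ => _).
have wu : ip w u = c * u e + c ^+ 2.
  by rewrite -ipC ip_lin uc ip_ketr ue' rmorphD rmorphM rmorphXn /= c' ue'.
have we : ip w (ket e) = c + u e.
  by rewrite ip_ketr /w /ket eqxx mulr1 rmorphD /= c' ue'.
have ww : ip w w = 2 * (c * (c + u e)) by rewrite ip_lin we wu; ring.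
have cu0 : c + u e != 0 by rewrite gt_eqF // ltr_wpDr.
rewrite /refl we ww /w; field.
by rewrite (gt_eqF c0).
Qed.

End Vectors.

(** * Query circuits *)

Section Circuits.
Variables (K : numClosedFieldType) (N : nat).
Notation X := {ffun 'I_N -> bool}.
Notation vec W := ((QB N * W)%type -> K).

Definition query (W : finType) (x : X) (v : vec W) : vec W :=
  fun s => (-1) ^+ chi x s.1 * v s.

Lemma query_unit (W : finType) (x : X) : unit_map (@query W x) (@query W x).
Proof.
apply: unit_map_selfadj.
- move=> a v w; apply: functional_extensionality => s; rewrite /query; ring.
- move=> v w; apply: eq_bigr => s _.
  by rewrite /query rmorphM /= rmorph_sign; ring.
- by move=> v; apply: functional_extensionality => s; rewrite /query signrMK.
Qed.

Fixpoint run (W : finType) (gs : nat -> vec W -> vec W) (x : X) n v :=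
  if n is n'.+1 then gs n (query x (run gs x n' v)) else gs 0 v.

(** The gates are fixed before [x] is known; only [query] sees [x]. *)
Definition impl (W : finType) n (F : X -> vec W -> vec W) :=
  exists gs gs', (forall i, unit_map (gs i) (gs' i)) /\
    forall x v, F x v = run gs x n v.

Lemma eq_run (W : finType) (gs hs : nat -> vec W -> vec W) x n v :
  (forall i, (i <= n)%N -> gs i = hs i) -> run gs x n v = run hs x n v.
Proof.
by elim: n => [|n IH] gh /=; rewrite gh // IH // => i /leqW; apply: gh.
Qed.

Lemma impl_gate (W : finType) (f g : vec W -> vec W) :
  unit_map f g -> impl 0 (fun=> f).
Proof. by move=> fU; exists (fun=> f), (fun=> g); split. Qed.

Lemma impl_query (W : finType) : impl 1 (@query W).
Proof.
by exists (fun=> id), (fun=> id); split=> // i; exact: unit_map_id.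
Qed.

Lemma impl_comp (W : finType) n m (F G : X -> vec W -> vec W) :
  impl n F -> impl m G -> impl (n + m) (fun x => G x \o F x).
Proof.
move=> [gs [gs' [gU gE]]] [hs [hs' [hU hE]]].
(* At index [n] the last gate of the first circuit fuses with gate 0 of the second, so the query
   counts add exactly. *)
pose ks i := if (i < n)%N then gs i else
  if i == n then hs 0 \o gs n else hs (i - n)%N.
pose ks' i := if (i < n)%N then gs' i else
  if i == n then gs' n \o hs' 0 else hs' (i - n)%N.
exists ks, ks'; split=> [i|x v].
  rewrite /ks /ks'; case: ifP => // _; case: ifP => // _.
  exact: unit_map_comp.
rewrite /= gE hE; elim: m {hE} => [|m IH].
  rewrite addn0; case: n {gE} @ks @ks' => [|n] ks ks' /=; first by rewrite /ks.
  rewrite /ks ltnn eqxx /=; congr (hs _ (gs _ (query _ _))).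
  by apply: eq_run => i; rewrite -ltnS => ->.
rewrite addnS /= IH /ks ltnNge leqW ?leq_addr //= -addnS.
by rewrite -[X in _ == X]addn0 eqn_add2l /= addKn.
Qed.

Lemma impl_iter (W : finType) n t (F : X -> vec W -> vec W) :
  impl n F -> impl (t * n) (fun x => iter t (F x)).
Proof.
move=> FI; elim: t => [|t IH]; first exact: impl_gate (@unit_map_id _ _).
by rewrite mulSnr; apply: impl_comp IH FI.
Qed.

(** All branches of a controlled circuit spend the same number of queries; this pads a branch that
    has nothing to do. *)
Lemma impl_idle (W : finType) n : exists F : X -> vec W -> vec W, impl n F.
Proof.
exists (fun x => iter n (query x)).
by have := @impl_iter W 1 n _ (@impl_query W); rewrite muln1.
Qed.

Lemma run_recl (W : finType) (gs : nat -> vec W -> vec W) x n v :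
  run gs x n.+1 v = run (gs \o S) x n (query x (gs 0 v)).
Proof. by elim: n => //= n <-. Qed.

(** Queries are involutions, so the inverse gates in reverse order undo the circuit at the same
    cost. *)
Lemma impl_inv (W : finType) n (F : X -> vec W -> vec W) : impl n F ->
  exists F', impl n F' /\ forall x, unit_map (F x) (F' x).
Proof.
move=> [gs [gs' [gU gE]]]; exists (fun x => run (fun i => gs' (n - i)%N) x n).
split.
  exists (fun i => gs' (n - i)%N), (fun i => gs (n - i)%N).
  by split=> // i; apply: unit_map_sym.
move=> x; have -> : F x = run gs x n by apply: functional_extensionality => v.
elim: n gs gs' gU {gE F} => [|n IH] gs gs' gU.
  by rewrite /= subn0; apply: gU.
have -> : run gs x n.+1 = run (gs \o S) x n \o (query x \o gs 0).
  by apply: functional_extensionality => v; rewrite run_recl.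
have -> : run (fun i => gs' (n.+1 - i)%N) x n.+1
   = (gs' 0 \o query x) \o run (fun i => (gs' \o S) (n - i)%N) x n.
  apply: functional_extensionality => v /=; rewrite subnn; congr (gs' _ (query _ _)).
  by apply: eq_run => i le_in; rewrite subSn.
apply: unit_map_comp; last by apply: IH => i; apply: gU.
by apply: unit_map_comp; [apply: gU | apply: query_unit].
Qed.

(** * Circuits controlled by a register *)

Section Control.
Variables (W' D W : finType) (f : W' * D -> W) (f' : W -> W' * D).
Hypotheses (fK : cancel f f') (f'K : cancel f' f).

Definition slice (c : D) (v : vec W) : vec W' := fun s => v (s.1, f (s.2, c)).
Definition ctrl (g : D -> vec W' -> vec W') (v : vec W) : vec W :=
  fun s => let: (w, c) := f' s.2 in g c (slice c v) (s.1, w).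

Lemma slice_ctrl g c v : slice c (ctrl g v) = g c (slice c v).
Proof.
by apply: functional_extensionality => -[q w]; rewrite {1}/slice /ctrl /= fK.
Qed.

Lemma eq_slice v v' : (forall c, slice c v = slice c v') -> v = v'.
Proof.
move=> vv; apply: functional_extensionality => -[q w].
case E: (f' w) => [w' c]; have := congr1 (@^~ (q, w')) (vv c).
by rewrite /slice /= -E f'K.
Qed.

Lemma ip_slice v v' : ip v v' = \sum_c ip (slice c v) (slice c v').
Proof.
have ipP (T : finType) (a b : vec T) :
    ip a b = \sum_q \sum_w (a (q, w))^* * b (q, w).
  by rewrite pair_bigA; apply: eq_bigr => -[].
rewrite ipP; under [RHS]eq_bigr do rewrite ipP.
rewrite [RHS]exchange_big; apply: eq_bigr => q _ /=.
rewrite exchange_big pair_bigA /= (reindex f) /=; first by apply: eq_bigr; case.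
by exists f' => ? _; [apply: fK | apply: f'K].
Qed.

Lemma ctrl_unit g g' : (forall c, unit_map (g c) (g' c)) ->
  unit_map (ctrl g) (ctrl g').
Proof.
move=> gU; split.
- move=> a v w; apply: eq_slice => c; rewrite slice_ctrl.
  have [gL _ _ _] := gU c.
  rewrite [slice c (fun _ => _)](_ : _ = fun s => a * slice c v s + slice c w s) //.
  by rewrite gL; apply: functional_extensionality => s; rewrite -!slice_ctrl.
- move=> v w; rewrite !ip_slice; apply: eq_bigr => c _; rewrite !slice_ctrl.
  by case: (gU c).
- by move=> v; apply: eq_slice => c; rewrite !slice_ctrl; case: (gU c).
- by move=> v; apply: eq_slice => c; rewrite !slice_ctrl; case: (gU c).
Qed.

Lemma slice_query c x v : slice c (query x v) = query x (slice c v).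
Proof. by []. Qed.

(** A query acts on the query register alone and so commutes with [slice]; the same [n] queries
    serve all branches in superposition. *)
Lemma impl_ctrl n (F : D -> X -> vec W' -> vec W') : (forall c, impl n (F c)) ->
  impl n (fun x => ctrl (fun c => F c x)).
Proof.
move=> /fin_all_exists[gs] /fin_all_exists[gs' gP].
exists (fun i => ctrl (fun c => gs c i)), (fun i => ctrl (fun c => gs' c i)).
split=> [i|x v]; first by apply: ctrl_unit => c; have [] := gP c.
apply: eq_slice => c; rewrite slice_ctrl; have [_ ->] := gP c.
by elim: n {gP} => [|n IH] /=; rewrite slice_ctrl // slice_query -IH.
Qed.

End Control.
End Circuits.

(** * Products and amplification of amplitudes *)

Section Amplitudes.
Variables (K : numClosedFieldType) (N : nat).
Notation X := {ffun 'I_N -> bool}.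
Notation vec W := ((QB N * W)%type -> K).
Notation impl := (@impl K N).

(* An [n]-query circuit reaches the outcome [o], which is one designated basis
   state, with amplitude [a x o]; nothing is said about the other basis states. *)
Definition amplitudes (O : finType) n (a : X -> O -> K) :=
  exists (W : finType) (s0 : QB N * W) (out : O -> QB N * W) F,
    [/\ injective out, impl n F & forall x o, F x (ket K s0) (out o) = a x o].

Definition test_amplitudes (O : finType) n (b : O -> X -> K) :=
  exists (W : finType) (s0 s1 : QB N * W) (G : O -> X -> vec W -> vec W),
    (forall o, impl n (G o)) /\ forall o x, G o x (ket K s0) s1 = b o x.

(** Run the first circuit, park its query register in memory, and run the test selected by the
    outcome on a fresh query register. *)
Lemma amplitudes_mul (O : finType) n m (a : X -> O -> K) (b : O -> X -> K) :
  amplitudes n a -> test_amplitudes m b ->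
  amplitudes (n + m) (fun x o => a x o * b o x).
Proof.
case=> W1 [s1 [out [F [outI FI FE]]]] [W2 [s2 [t2 [G [GI GE]]]]].
pose W : finType := (W1 * (QB N * W2))%type.
pose swap (s : QB N * W) : QB N * W := (s.2.2.1, (s.2.1, (s.1, s.2.2.2))).
have swapK : involutive swap by case=> [q [w1 [q' w2]]].
pose A2 (v : vec W) : vec W := v \o swap.
have A2U : unit_map A2 A2.
  apply: unit_map_selfadj => //.
  - by move=> v w; rewrite /ip (reindex_inj (inv_inj swapK)); apply: eq_bigr => s _; rewrite /A2 /= swapK.
  - by move=> v; apply: functional_extensionality => s; rewrite /A2 /= swapK.
have [I II] := @impl_idle K N W2 m.
(* Control values that encode no outcome idle for [m] queries. *)
pose Gc c := if [pick o | out o == c] is Some o then G o else I.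
have GcI c : impl m (Gc c) by rewrite /Gc; case: pickP.
have A1I := @impl_ctrl K N W1 (QB N * W2)%type W id id (fun _ => erefl) (fun _ => erefl) n
  (fun=> F) (fun=> FI).
pose f (p : W2 * (QB N * W1)) : W := (p.2.2, (p.2.1, p.1)).
pose f' (p : W) : W2 * (QB N * W1) := (p.2.2, (p.2.1, p.1)).
have fK : cancel f f' by case=> [? []].
have f'K : cancel f' f by case=> [? []].
have A3I := @impl_ctrl K N W2 (QB N * W1)%type W f f' fK f'K m Gc GcI.
have := impl_comp (impl_comp A1I (impl_gate A2U)) A3I; rewrite addn0 => HI.
pose out' o : QB N * W := (t2.1, ((out o).2, ((out o).1, t2.2))).
exists W, (s1.1, (s1.2, (s2.1, s2.2))), out'; eexists; split; [|exact: HI|].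
  by move=> o o' [] e2 e1; apply: outI; case: (out o) (out o') e1 e2 => ? ? [? ?] /= -> ->.
move=> x o /=; rewrite {1}/ctrl /out' /=.
have -> : Gc ((out o).1, (out o).2) = G o.
  by rewrite -surjective_pairing /Gc; case: pickP => [o' /eqP/outI -> //|/(_ o)]; rewrite eqxx.
have implL (W' : finType) r (H : X -> vec W' -> vec W') : impl r H -> lin (H x).
  by case/impl_inv=> H' [_ /(_ x) []].
have sliceE c : @slice K N W1 (QB N * W2)%type W id c (ket K (s1.1, (s1.2, (s2.1, s2.2)))) =
    fun s => (c == s2)%:R * ket K s1 s.
  apply: functional_extensionality => -[q w]; rewrite /slice /ket -natrM mulnb.
  case: c s1 s2 {outI FI FE A1I GE HI A2U f f' fK f'K A3I out' A2 swap swapK Gc GcI} => [q1 w1] [q2 w2] [q3 w3].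
  by rewrite /= !xpair_eqE; congr ((_ : bool)%:R); do 4 case: eqP.
rewrite [slice _ _ _](_ : _ = fun s => a x o * ket K s2 s).
  by rewrite (linZ _ _ (implL _ _ _ (GI o))) -surjective_pairing GE.
apply: functional_extensionality => -[q w].
by rewrite /slice /A2 /= /ctrl /= sliceE (linZ _ _ (implL _ _ _ FI)) -FE -surjective_pairing mulrC.
Qed.

(** One Grover iteration: conjugating the reflection at [s0] by [F] gives the reflection at [psi],
    and [ip psi (mark psi)] is [1 - 2 p] with [p] the total probability of the designated
    outcomes. *)
Lemma amplitudes_amplify (O : finType) n (a : X -> O -> K) : amplitudes n a ->
  amplitudes (3 * n) (fun x o => (3 - 4 * \sum_o' `|a x o'| ^+ 2) * a x o).
Proof.
case=> W [s0 [out [F [outI FI FE]]]].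
have [F' [FI' FU]] := impl_inv FI.
pose mark (v : vec W) : vec W := fun s => (-1) ^+ (s \in codom out) * v s.
have markU : unit_map mark mark.
  apply: unit_map_selfadj.
  - move=> b v w; apply: functional_extensionality => s; rewrite /mark; ring.
  - move=> v w; apply: eq_bigr => s _.
    by rewrite /mark rmorphM /= rmorph_sign; ring.
  - by move=> v; apply: functional_extensionality => s; rewrite /mark signrMK.
pose R := refl (ket K s0).
have := impl_comp (impl_comp (impl_comp FI (impl_gate markU)) FI')
  (impl_comp (impl_gate (refl_unit (ket K s0))) FI).
rewrite addn0 add0n (_ : n + n + n = 3 * n)%N; last by rewrite !mulSn addn0 addnA.
move=> HI; exists W, s0, out; eexists; split; [by [] | exact: HI |].
move=> x o /=; set psi := F x (ket K s0).
have psiE o' : psi (out o') = a x o' := FE x o'.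
have [FL FO FK FK'] := FU x.
have k1 : ip (ket K s0) (ket K s0) = 1 by rewrite ip_ketl /ket eqxx.
rewrite reflE k1 divr1 (FL (2 * _)) (linZ _ _ FL) FK' -/psi.
rewrite (unit_map_adj _ _ (FU x)) -/psi.
have mo : mark psi (out o) = - psi (out o).
  by rewrite /mark codom_f mulN1r.
rewrite mo psiE.
have -> : ip psi (mark psi) = 1 - 2 * \sum_o' `|a x o'| ^+ 2.
  have pp : ip psi psi = 1 by rewrite FO.
  rewrite -[X in X - _]pp [ip psi psi]ip_norm /ip (eq_bigr (fun s => `|psi s| ^+ 2 - 2 * ((s \in codom out)%:R * `|psi s| ^+ 2))).
    rewrite sumrB -mulr_sumr; congr (_ - 2 * _).
    rewrite (eq_bigr (fun s => if s \in codom out then `|psi s| ^+ 2 else 0)).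
      under [RHS]eq_bigr do rewrite -psiE.
      transitivity (\sum_(s in out @: setT) `|psi s| ^+ 2).
        rewrite -big_mkcond; apply: eq_bigl => s.
        by apply/codomP/imsetP => [[o' ->]|[o' _ ->]]; exists o'.
      rewrite big_imset /=; last by move=> o1 o2 _ _ /outI.
      by apply: eq_bigl => o'; rewrite inE.
    by move=> s _; case: ifP; rewrite ?mul1r ?mul0r.
  move=> s _; rewrite /mark mulrCA -normCKC; case: (s \in _); rewrite /= ?expr1 ?expr0; ring.
ring.
Qed.

End Amplitudes.

(** * Chebyshev walks *)

Fixpoint cheb (R : comNzRingType) t (z : R) : R :=
  if t is t'.+1 then if t' is t''.+1 then 2 * z * cheb t' z - cheb t'' z else z
  else 1.

Lemma chebSS (R : comNzRingType) t (z : R) :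
  cheb t.+2 z = 2 * z * cheb t.+1 z - cheb t z.
Proof. by []. Qed.

Lemma nat_ind2 (P : nat -> Prop) :
  P 0%N -> P 1%N -> (forall n, P n -> P n.+1 -> P n.+2) -> forall n, P n.
Proof.
move=> P0 P1 PS n; suff [] : P n /\ P n.+1 by [].
by elim: n => [|n [Pn Pn1]]; split=> //; apply: PS.
Qed.

Lemma ratr_cheb (K : numFieldType) t (z : rat) : ratr (cheb t z) = cheb t (ratr z) :> K.
Proof.
elim/nat_ind2: t => [||t IH IH1]; rewrite ?rmorph1 //.
by rewrite !chebSS rmorphB !rmorphM /= IH IH1 ratr_nat.
Qed.

Section Sampling.
Variables (K : numClosedFieldType) (N : nat).
Notation X := {ffun 'I_N -> bool}.
Notation vec W := ((QB N * W)%type -> K).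
Notation impl := (@impl K N).

Lemma null_queryP : is_Bquery [ffun i : 'I_N => ord0 : 'I_3].
Proof. by apply/eqP; apply: eq_card => i; rewrite !inE !ffunE. Qed.
Definition null_query : QB N := exist (fun q => is_Bquery q) _ null_queryP.

Lemma chi_null x : chi x null_query = false.
Proof.
by apply/negbTE/negPn/eqP/big1 => i _; rewrite ffunE mul0r.
Qed.

(** Since [ip u u = 2], the reflection at [u] has diagonal entry [(1 + beta) - 1] at [s0].
    Multiplying by this query-free test lowers an amplitude to a prescribed value. *)
Lemma test_amplitudes_const (O : finType) (beta : K) : -1 <= beta <= 1 ->
  @test_amplitudes K N O 0 (fun _ _ => beta).
Proof.
move=> /andP[b1 b2].
have [p1 p2] : 0 <= 1 + beta /\ 0 <= 1 - beta.
  by split; rewrite ?subr_ge0 // addrC -[1]opprK subr_ge0.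
pose s0 := (null_query, false); pose s1 := (null_query, true).
pose u := fun s => sqrtC (1 + beta) * ket K s0 s + (sqrtC (1 - beta) * ket K s1 s).
exists bool, s0, s0, (fun _ _ => refl u); split=> [_|_ _].
  exact: impl_gate (refl_unit u).
have sr (z : K) : 0 <= z -> (sqrtC z)^* = sqrtC z.
  by move=> z0; apply: CrealP; apply: ger0_real; rewrite sqrtC_ge0.
have s01 : (s0 == s1) = false by rewrite xpair_eqE andbF.
have u0 : u s0 = sqrtC (1 + beta) by rewrite /u /ket eqxx s01 mulr1 mulr0 addr0.
have u1 : u s1 = sqrtC (1 - beta) by rewrite /u /ket eqxx eq_sym s01 mulr1 mulr0 add0r.
have uu : ip u u = 2.
  rewrite [ip u u](ip_lin u (sqrtC (1 + beta)) (ket K s0)) ipZ !ip_ketr u0 u1 !sr //.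
  rewrite -!expr2 !sqrtCK; ring.
rewrite /refl uu ip_ketr u0 sr // /ket eqxx.
rewrite mulr1n; transitivity (sqrtC (1 + beta) ^+ 2 - 1); first by field.
rewrite sqrtCK; ring.
Qed.

(** With [M = refl u \o query x] and [z] the argument of [cheb], [M u = 2 z u - query x u], whence
    [M (M u) = 2 z M u - u]: the Chebyshev recurrence. The reflection [refl w] prepares [u / c] and
    finally reads off the overlap with it. *)
Lemma chebyshev_walk (W : finType) (e : QB N * W) (u : vec W) (c : K) t :
  0 < c -> ip u u = c ^+ 2 -> 0 <= u e ->
  exists F, impl t F /\
    forall x, F x (ket K e) e = cheb t (ip u (query x u) / ip u u).
Proof.
move=> c0 uc ue.
pose w := fun s => c * ket K e s + u s.
have R1 := impl_gate (refl_unit w).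
have V1 := impl_comp (@impl_query K N W) (impl_gate (refl_unit u)).
have := impl_comp (impl_comp R1 (impl_iter t V1)) R1.
rewrite !addn0 muln1 add0n => HI; eexists; split; first exact: HI.
move=> x /=; set M := refl u \o query x.
have ML : lin M.
  move=> a v v'; rewrite /M /=; have [-> _ _ _] := @query_unit K N W x; exact: refl_lin.
have iL : lin (iter t M).
  by elim: t {HI} => [|t IH] a v v' //=; rewrite IH ML.
rewrite (refl_prep c0 uc ue) (linZ _ _ iL) -(ip_ketl e).
rewrite (unit_map_adj _ _ (refl_unit w)) (refl_prep c0 uc ue) ipZl ipZ.
have cV : (c^-1)^* = c^-1 by apply: CrealP; rewrite realV; apply: ger0_real (ltW c0).
have uu0 : ip u u != 0 by rewrite uc expf_neq0 // gt_eqF.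
set z := _ / _.
suff -> : ip u (iter t M u) = ip u u * cheb t z.
  by rewrite cV uc; field; rewrite gt_eqF.
have Mu : M u = fun s => 2 * z * u s + (-1) * query x u s.
  by apply: functional_extensionality => s; rewrite /M /= /refl /z mulN1r mulrA.
have MMu : M (M u) = fun s => 2 * z * M u s + (-1) * u s.
  rewrite {1}Mu ML; apply: functional_extensionality => s; congr (_ + _).
  have [_ _ _ qK] := @query_unit K N W x.
  by rewrite (linZ _ _ ML) /M /= qK refl_self.
elim/nat_ind2: t {HI iL} => [||t IH IH1]; first by rewrite mulr1.
  by rewrite /= -/(M u) Mu ip_lin ipZ /z; field.
rewrite !iterSr MMu.
have iL : lin (iter t M) by elim: t {IH IH1} => [|t IH] a v v' //=; rewrite IH ML.
rewrite (iL _ (M u)) (linZ _ _ iL) ip_lin ipZ -iterSr IH IH1 chebSS; ring.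
Qed.
End Sampling.

(** * Fourier sampling of a family of queries *)

Section Characters.
Variable D : finType.
Implicit Types (A B T : {set D}) (i : D).

Definition toggle i T := if i \in T then T :\ i else i |: T.

Lemma toggle_in i T j : (j \in toggle i T) = (j == i) (+) (j \in T).
Proof.
rewrite /toggle; case: ifP => iT; rewrite !inE; have [->|] //= := eqVneq j i.
- by rewrite iT.
- by rewrite iT.
Qed.

Lemma toggleK i : involutive (toggle i).
Proof. by move=> T; apply/setP => j; rewrite !toggle_in addKb. Qed.

Lemma sign_toggle (R : comNzRingType) A i T :
  (-1) ^+ #|A :&: toggle i T| = (-1) ^+ (i \in A) * (-1) ^+ #|A :&: T| :> R.
Proof.
wlog iT : T / i \notin T => [H|].
  have [iT|/H //] := boolP (i \in T).
  by rewrite -[in RHS](toggleK i T) (H (toggle i T)) ?signrMK ?toggle_in ?eqxx ?iT // toggleK.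
rewrite /toggle (negPf iT) setIUr -signr_odd.
have [iA|iA] := boolP (i \in A).
  rewrite (_ : A :&: [set i] = [set i]); last by apply/setIidPr; rewrite sub1set.
  by rewrite cardsU1 inE (negPf iT) andbF signr_odd exprD.
rewrite (_ : A :&: [set i] = set0) ?set0U ?signr_odd ?mul1r //.
by apply/setP => j; rewrite !inE; apply: contraNF iA => /andP[? /eqP <-].
Qed.

Lemma sum_sign0 (R : realDomainType) A (h : {set D} -> {set D}) (P : pred {set D})
  (F : {set D} -> R) : injective h ->
  (forall T, (-1) ^+ #|A :&: h T| = - (-1) ^+ #|A :&: T| :> R) ->
  (forall T, P (h T) = P T) -> (forall T, F (h T) = F T) ->
  \sum_(T | P T) (-1) ^+ #|A :&: T| * F T = 0.
Proof.
move=> hI hA hP hF; set s := \sum_(_ | _) _; suff: s = - s by lra.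
rewrite {1}/s (reindex_inj hI) (eq_bigl P) // -sumrN.
by apply: eq_bigr => T _; rewrite hA hF mulNr.
Qed.

Lemma sign_orthogonal (R : comNzRingType) A B :
  \sum_T (-1) ^+ #|A :&: T| * (-1) ^+ #|T :&: B| =
  if A == B then 2 ^+ #|D| else 0 :> R.
Proof.
(* In a general ring [s = - s] does not force [s = 0], so the identity is proved over the integers
   and mapped to [R]. *)
suff E : \sum_T (-1) ^+ #|A :&: T| * (-1) ^+ #|T :&: B| =
  if A == B then 2 ^+ #|D| else 0 :> int.
  have := congr1 (fun z => z%:~R : R) E.
  rewrite rmorph_sum /= (eq_bigr (fun T => (-1) ^+ #|A :&: T| * (-1) ^+ #|T :&: B|)).
    by move=> ->; case: ifP; rewrite ?rmorphXn.
  by move=> T _; rewrite rmorphM !rmorphXn /= rmorphN1.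
have [->|/eqP AB] := eqVneq A B.
  rewrite (eq_bigr (fun=> 1)) => [|T _]; last by rewrite setIC -expr2 sqrr_sign.
  by rewrite sumr_const (_ : #|_| = 2 ^ #|D|)%N ?natrX // -(cardsT D) -card_powerset powersetT cardsT; apply: eq_card.
have [i iAB] : exists i, (i \in A) (+) (i \in B).
  apply/existsP; apply: contra_notT AB => /existsPn H; apply/setP => i.
  by have := H i; rewrite addbC; case: (i \in A); case: (i \in B).
set s := \sum_T _; suff: s = - s by lia.
rewrite {1}/s (reindex_inj (inv_inj (toggleK i))) -sumrN; apply: eq_bigr => T _.
rewrite !(setIC _ B) !sign_toggle mulrACA -signr_addb iAB expr1; ring.
Qed.

End Characters.

Section Sampler.
Variables (K : numClosedFieldType) (N : nat) (D M : finType).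
Variables (q : {set D} -> M -> QB N) (supp : {set D} -> {set M}) (q0 : QB N) (m0 : M).
Hypothesis supp0 : forall S, (0 < #|supp S|)%N.
Notation X := {ffun 'I_N -> bool}.
Notation vec W := ((QB N * W)%type -> K).

(** Twice the probability of balance minus 1; this is the cosine fed to the walk. *)
Definition bias (x : X) (S : {set D}) : rat :=
  (\sum_(m in supp S) (-1) ^+ chi x (q S m)) / #|supp S|%:R.

(** Fourier coefficient at [A] of [cheb t] of the bias. Keeping it rational lets the estimates take
    place in a totally ordered field. *)
Definition sample_amp t (x : X) (A : {set D}) : rat :=
  (\sum_(S : {set D}) (-1) ^+ #|A :&: S| * cheb t (bias x S)) / 2 ^+ #|D|.

(** Unnormalised uniform superposition of the splits; the register [m] keeps apart splits that give
    the same query. *)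
Let u S : vec M := fun s => ((s.1 == q S s.2) && (s.2 \in supp S))%:R.

Let ip_u S v : ip (u S) v = \sum_(m in supp S) v (q S m, m).
Proof.
rewrite /ip (eq_bigr (fun s => (u S (s.1, s.2))^* * v (s.1, s.2))); last by case.
rewrite -(pair_bigA _ (fun a b => (u S (a, b))^* * v (a, b))) exchange_big [RHS]big_mkcond.
apply: eq_bigr => m _; rewrite (bigD1 (q S m)) //= big1 ?addr0 => [|r /negPf rq].
  by rewrite /u eqxx /= conjC_nat; case: ifP; rewrite ?mul1r ?mul0r.
by rewrite /u /= rq conjC_nat mul0r.
Qed.

Let hc : K := sqrtC (2 ^- #|D|).

Let had (v : vec (M * {set D})%type) : vec (M * {set D})%type := fun s =>
  hc * \sum_T (-1) ^+ #|s.2.2 :&: T| * v (s.1, (s.2.1, T)).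

Let hc2 : hc * hc = 2 ^- #|D|. Proof. by rewrite -expr2 sqrtCK. Qed.

Let hc_real : hc^* = hc.
Proof.
by apply: CrealP; apply: ger0_real; rewrite sqrtC_ge0 invr_ge0 exprn_ge0.
Qed.

Let had_unit : unit_map had had.
Proof.
apply: unit_map_selfadj.
- move=> a v w; apply: functional_extensionality => s; rewrite /had.
  rewrite [a * (hc * _)]mulrCA -mulrDr [a * \sum_T _]mulr_sumr -big_split; congr (_ * _).
  by apply: eq_bigr => T _ /=; ring.
- move=> v w.
  have ipP (a b : vec (M * {set D})%type) :
      ip a b = \sum_r \sum_T (a (r.1, (r.2, T)))^* * b (r.1, (r.2, T)).
    rewrite pair_bigA /ip (reindex (fun p : (QB N * M) * {set D} => (p.1.1, (p.1.2, p.2)))) //=.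
    by exists (fun s => ((s.1, s.2.1), s.2.2)) => -[] => [[]|? []].
  rewrite !ipP; apply: eq_bigr => r _.
  under eq_bigr => T _ do rewrite /had rmorphM /= hc_real rmorph_sum mulrAC mulr_sumr.
  rewrite exchange_big; apply: eq_bigr => T _; rewrite /had /= mulrA mulr_sumr.
  by apply: eq_bigr => T' _; rewrite rmorphM /= rmorphXn rmorphN1 setIC /=; ring.
- move=> v; apply: functional_extensionality => -[r [m A]]; rewrite /had /=.
  under eq_bigr do rewrite mulrCA mulr_sumr.
  rewrite -mulr_sumr mulrA hc2 exchange_big.
  under eq_bigr => B _ do under eq_bigr => T _ do rewrite mulrA.
  under eq_bigr => B _ do rewrite -mulr_suml sign_orthogonal.
  rewrite (bigD1 A) //= eqxx big1 ?addr0 => [|B /negPf].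
    by rewrite mulKf // expf_neq0 ?pnatr_eq0.
  by rewrite eq_sym => ->; rewrite mul0r.
Qed.

(** Bernstein-Vazirani with the phase at [S] replaced by the walk amplitude. Only basis states where
    the walk has returned to [(q0, m0)] are read. *)
Lemma sampler t : exists F, @impl K N (M * {set D})%type t F /\ forall x A,
  F x (ket K (q0, (m0, set0))) (q0, (m0, A)) = ratr (sample_amp t x A).
Proof.
have uu S : ip (u S) (u S) = #|supp S|%:R.
  rewrite ip_u (eq_bigr (fun=> 1)) ?sumr_const // => m mS.
  by rewrite /u /= eqxx mS.
have uq S x : ip (u S) (query x (u S)) / ip (u S) (u S) = ratr (bias x S).
  rewrite uu ip_u /bias rmorphM fmorphV rmorph_nat rmorph_sum; congr (_ / _).
  apply: eq_bigr => m mS; rewrite rmorphXn /= rmorphN1 /query /=.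
  by rewrite /u /= eqxx mS mulr1.
have /fin_all_exists[F FP] S : exists F, @impl K N M t F /\
    forall x, F x (ket K (q0, m0)) (q0, m0) = cheb t (ratr (bias x S)).
  have [|||F [FI FE]] := @chebyshev_walk K N M (q0, m0) (u S) (sqrtC #|supp S|%:R) t.
  - by rewrite sqrtC_gt0 ltr0n.
  - by rewrite uu sqrtCK.
  - by rewrite /u ler0n.
  by exists F; split=> // x; rewrite FE uq.
have CI := @impl_ctrl K N M {set D} (M * {set D})%type id id (fun _ => erefl)
  (fun _ => erefl) t F (fun S => (FP S).1).
have := impl_comp (impl_comp (impl_gate had_unit) CI) (impl_gate had_unit).
rewrite addn0 add0n => HI; eexists; split; first exact: HI.
move=> x A /=; rewrite {1}/had /= /sample_amp rmorphM fmorphV rmorphXn /= ratr_nat.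
rewrite -hc2 mulrA [RHS]mulrC; congr (_ * _).
rewrite rmorph_sum mulr_suml; apply: eq_bigr => S _ /=.
rewrite rmorphM rmorphXn rmorphN1 /= -mulrA; congr (_ * _).
rewrite /ctrl /=.
rewrite [slice _ _ _](_ : _ = fun s => hc * ket K (q0, m0) s).
  have [F' [_ /(_ x) [FL _ _ _]]] := impl_inv (FP S).1.
  by rewrite (linZ _ _ FL) (FP S).2 ratr_cheb mulrC.
apply: functional_extensionality => -[r m]; rewrite /slice /had /ket /=.
congr (_ * _); rewrite (bigD1 set0) //= setI0 cards0 mul1r big1 ?addr0 => [|T /negPf T0].
  by rewrite !xpair_eqE eqxx andbT.
by rewrite !xpair_eqE T0 !andbF mulr0.
Qed.

End Sampler.

(** * Estimates *)

Lemma cheb_opp (R : comNzRingType) t (z : R) : cheb t (- z) = (-1) ^+ t * cheb t z.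
Proof.
elim/nat_ind2: t => [||t IH IH1]; rewrite ?mul1r ?expr1 ?mulN1r //.
rewrite !chebSS IH IH1 !exprS; ring.
Qed.

Lemma cheb1 (R : comNzRingType) t : cheb t (1 : R) = 1.
Proof. by elim/nat_ind2: t => [||t IH IH1] //; rewrite chebSS IH IH1; ring. Qed.

(** The left side is an invariant of the recurrence; it stands in for [cos^2 + sin^2 = 1], so no
    angles appear. *)
Lemma cheb_pell (R : comNzRingType) t (y : R) :
  cheb t.+1 y ^+ 2 + cheb t y ^+ 2 - 2 * y * cheb t.+1 y * cheb t y = 1 - y ^+ 2.
Proof. by elim: t => [|t IH]; [rewrite /=; ring | rewrite chebSS -IH; ring]. Qed.

Lemma sum_cheb (R : comNzRingType) t (y : R) :
  (2 - 2 * y) * \sum_(i < t.+1) cheb i y = cheb t y - cheb t.+1 y + (1 - y).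
Proof.
elim: t => [|t IH]; first by rewrite big_ord_recr big_ord0 /=; ring.
by rewrite big_ord_recr mulrDr IH chebSS /=; ring.
Qed.

(** By [cheb_pell] the nonnegative terms [(1 - y) (a + b)^2] and [(1 + y) (b - a)^2] add up to
    [2 (1 - y^2)]. The point [y = -1] is separate because [1 + y] is cancelled. *)
Lemma cheb_step (R : realFieldType) t (y : R) : -1 <= y <= 1 ->
  (cheb t y - cheb t.+1 y) ^+ 2 <= 2 * (1 - y).
Proof.
move=> /andP[y1 y2]; have [y0|y0] := eqVneq y (-1).
  rewrite y0 !cheb_opp !cheb1 (exprS _ t).
  rewrite (_ : _ * 1 - _ = 2 * (-1) ^+ t); last by ring.
  rewrite exprMn sqrr_sign; lra.
have y3 : 0 < 1 + y by rewrite lt_neqAle eq_sym addrC addr_eq0 y0; lra.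
rewrite -(ler_pM2l y3); have := cheb_pell t y.
set a := cheb t.+1 y; set b := cheb t y => E.
have : 0 <= (1 - y) * (a + b) ^+ 2 by rewrite mulr_ge0 ?sqr_ge0 // subr_ge0.
have -> : (1 - y) * (a + b) ^+ 2 = 2 * (1 - y ^+ 2) - (1 + y) * (b - a) ^+ 2.
  by rewrite -E; ring.
have -> : (1 + y) * (2 * (1 - y)) = 2 * (1 - y ^+ 2) by ring.
by rewrite subr_ge0.
Qed.

(** For the sum [d], [sum_cheb] and [cheb_step] give [2 d - 1 <= p^(-1/2)], which is at most
    [(3 k)^(1/4)]. As [1875 = 3 * 5^4], that is at most [t / 5], and [t >= 5] absorbs the 1. *)
Lemma cheb_mean (R : realFieldType) (k t : nat) (p : R) :
  0 <= p <= 1 -> 1 <= p ^+ 2 * (3 * k)%:R -> (0 < k)%N -> (1875 * k <= t ^ 4)%N ->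
  \sum_(i < t) cheb i (1 - 2 * p) <= t%:R / 5.
Proof.
move=> /andP[p0 p1] pk k0 tk.
have t5 : (5 <= t)%N.
  by rewrite leqNgt; apply/negP => t5; have : (t ^ 4 <= 4 ^ 4)%N; [rewrite leq_exp2r | lia].
have pp : 0 < p.
  by rewrite lt_neqAle p0 andbT; apply: contraTneq pk => <-; rewrite expr0n mul0r ler10.
case: t t5 tk => // t t5 tk; set d := \sum_(i < _) _; rewrite leNgt; apply/negP => dt.
have /(cheb_step t) s : -1 <= 1 - 2 * p <= 1 by lra.
have {s} := s; have := sum_cheb t (1 - 2 * p); rewrite -/d.
set e := cheb t _ - _ => E s.
have {E} E : e = 2 * p * (2 * d - 1) by lra.
set u := 2 * d - 1 in E.
have tu : t.+1%:R / 5 < u.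
  have : 5%:R <= t.+1%:R :> R by rewrite ler_nat.
  rewrite /u; lra.
have pu : p * u ^+ 2 <= 1.
  rewrite -(ler_pM2l pp) mulr1; move: s; rewrite E; rewrite (_ : (2 * p * u) ^+ 2 = 4 * (p * (p * u ^+ 2))); last by ring.
  lra.
have u4 : (3 * k)%:R < u ^+ 4.
  apply: (@le_lt_trans _ _ ((t.+1%:R / 5) ^+ 4)); last by rewrite ltrXn2r // ?divr_ge0 //; lra.
  rewrite expr_div_n ler_pdivlMr; last by rewrite exprn_gt0.
  rewrite -!natrX -natrM ler_nat; lia.
have : p ^+ 2 * u ^+ 4 <= 1.
  rewrite (_ : _ * _ = (p * u ^+ 2) ^+ 2); last by ring.
  by apply: exprn_ile1 => //; rewrite mulr_ge0 ?sqr_ge0.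
apply/negP; rewrite -ltNge; apply: (le_lt_trans pk).
by rewrite ltr_pM2l // exprn_gt0.
Qed.

(** * Choice of the walk length by averaging *)

Section Pigeonhole.
Variables (D : finType) (A : {set D}) (E : pred {set D}) (z : {set D} -> rat) (k T : nat).
Hypotheses (k_gt0 : (0 < k)%N) (T_large : (1875 * k <= T ^ 4)%N).
Hypothesis z_odd : forall S, E S -> odd #|A :&: S| -> z S = -1.
Hypothesis z_even : forall S, E S -> ~~ odd #|A :&: S| ->
  exists p : rat, [/\ z S = 2 * p - 1, 0 <= p <= 1 & 1 <= p ^+ 2 * (3 * k)%:R].
Hypothesis z_out : forall S, ~~ E S -> z S = 1.
Hypothesis E_bal : \sum_(S | E S) (-1) ^+ #|A :&: S| = 0 :> rat.
Hypothesis E_balC : \sum_(S | ~~ E S) (-1) ^+ #|A :&: S| = 0 :> rat.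

(* Averaging over [t] with signs [(-1)^t] annihilates the even sets up to 1/5,
   because their Chebyshev angles are bounded away from 0, and keeps the odd ones. *)
Lemma exists_walk_length : exists2 t, (t < T)%N &
  2 / 5 * #|[set S | E S]|%:R <= `|\sum_S (-1) ^+ #|A :&: S| * cheb t (z S)|.
Proof.
have T0 : (0 < T)%N.
  by have := T_large; case: (T) => //; rewrite exp0n // leqn0 muln_eq0 /= eqn0Ngt k_gt0.
pose a t : rat := \sum_S (-1) ^+ #|A :&: S| * cheb t (z S).
pose e : rat := #|[set S | E S]|%:R.
have sumE : \sum_(t < T) (-1) ^+ t * a t <= - (T%:R * (2 / 5 * e)).
  have -> : \sum_(t < T) (-1) ^+ t * a t =
      \sum_S (-1) ^+ #|A :&: S| * \sum_(t < T) cheb t (- z S).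
    under eq_bigr do rewrite mulr_sumr.
    rewrite exchange_big; apply: eq_bigr => S _; rewrite mulr_sumr.
    by apply: eq_bigr => t _; rewrite cheb_opp mulrCA.
  rewrite (bigID E) /= [X in _ + X](_ : _ = 0) ?addr0; last first.
    transitivity ((\sum_(S | ~~ E S) (-1) ^+ #|A :&: S|) * \sum_(t < T) cheb t (- 1 : rat)).
      rewrite mulr_suml.

      by apply: eq_bigr => S /z_out ->.
    by rewrite E_balC mul0r.
  (* The bound is affine in the sign: [T / 5] at sign 1 and [- T] at sign -1. Balance of [E] then
     kills the term containing the sign. *)
  apply: (@le_trans _ _ (\sum_(S | E S) (3 / 5 * T%:R * (-1) ^+ #|A :&: S| - 2 / 5 * T%:R))).
    apply: ler_sum => S ES; have [odS|evS] := boolP (odd #|A :&: S|).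
      rewrite -signr_odd odS (z_odd ES odS) opprK.
      under eq_bigr do rewrite cheb1.
      rewrite sumr_const card_ord expr1; lra.
    have [p [-> p01 pk]] := z_even ES evS.
    have -> : - (2 * p - 1) = 1 - 2 * p by ring.
    have := cheb_mean p01 pk k_gt0 T_large.
    rewrite -signr_odd (negPf evS) expr0; lra.
  rewrite sumrB -mulr_sumr E_bal mulr0 sumr_const -[X in _ - X]mulr_natl.
  rewrite (_ : #|_|%:R = e); last by rewrite /e; congr _%:R; apply: eq_card => S; rewrite !inE.
  lra.
have [/existsP[t tP]|/existsPn H] := boolP [exists t : 'I_T, 2 / 5 * e <= `|a t|].
  by exists t.
have : \sum_(t < T) (2 / 5 * e) <= \sum_(t < T) `|a t|.
  rewrite sumr_const card_ord -[X in X <= _]mulr_natl.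
  have := ler_norm (- \sum_(t < T) (-1) ^+ t * a t); rewrite normrN.
  have : `|\sum_(t < T) (-1) ^+ t * a t| <= \sum_(t < T) `|(-1) ^+ t * a t| by exact: ler_norm_sum.
  have -> : \sum_(t < T) `|(-1) ^+ t * a t| = \sum_(t < T) `|a t|.
    by apply: eq_bigr => t _; rewrite normrMsign.
  lra.
rewrite leNgt => /negP[]; apply: ltr_sum => [|t _]; last by rewrite ltNge H.
by apply/hasP; exists (Ordinal T0); rewrite ?mem_index_enum.
Qed.
End Pigeonhole.

(** * Central binomial coefficients and the probability of balance *)

Lemma central_bin_step v : (v.+1 * 'C(v.+1.*2, v.+1) = 2 * v.*2.+1 * 'C(v.*2, v))%N.
Proof.
have H1 := mul_bin_diag v.+1.*2 v; have H2 := mul_bin_down v.*2.+1 v.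
rewrite doubleS /= in H1 H2 *.
have E : (v.*2.+1 - v = v.+1)%N by lia.
rewrite E in H2; nia.
Qed.

(** This is the order [v^(-1/2)] of the probability of a tie, squared to avoid roots. In the
    induction step the two polynomial factors differ by just 4. *)
Lemma central_bin_lb v : (16 ^ v <= 'C(v.*2, v) ^ 2 * (4 * v).+1)%N.
Proof.
elim: v => [|v IH] //; have := central_bin_step v.
set c := 'C(_, _); set c' := 'C(v.*2, v) in IH * => E.
rewrite -(@leq_pmul2l (v.+1 ^ 2)) ?expn_gt0 //.
have -> : (v.+1 ^ 2 * (c ^ 2 * (4 * v.+1).+1) = (v.+1 * c) ^ 2 * (4 * v.+1).+1)%N by ring.
rewrite E (expnS 16).
apply: (@leq_trans (16 * v.+1 ^ 2 * (c' ^ 2 * (4 * v).+1))).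
  move: (16 ^ v)%N (c' ^ 2 * (4 * v).+1)%N (v.+1 ^ 2)%N IH => a b d ab; nia.
have -> : ((2 * v.*2.+1 * c') ^ 2 * (4 * v.+1).+1 = c' ^ 2 * (4 * v.*2.+1 ^ 2 * (4 * v.+1).+1))%N by ring.
have -> : (16 * v.+1 ^ 2 * (c' ^ 2 * (4 * v).+1) = c' ^ 2 * (16 * v.+1 ^ 2 * (4 * v).+1))%N by ring.
rewrite leq_mul2l; apply/orP; right.
rewrite (_ : 4 * _ * _ = 16 * v.+1 ^ 2 * (4 * v).+1 + 4)%N ?leq_addr // -muln2; ring.
Qed.

Lemma central_bin_ub v : ('C(v.+1.*2, v.+1) <= 4 * 'C(v.*2, v))%N.
Proof.
rewrite -(@leq_pmul2l v.+1) // central_bin_step mulnA leq_mul2r; apply/orP; right; lia.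
Qed.

Lemma central_bin_ratio v m :
  ('C((v + m).*2, v + m) <= 4 ^ v * 'C(m.*2, m))%N.
Proof.
elim: v => [|v IH]; first by rewrite mul1n.
rewrite addSn expnS -mulnA; apply: leq_trans (central_bin_ub _) _.
by rewrite leq_mul2l IH orbT.
Qed.

(** The factor 3 comes from [4 v + 1 <= 2 k + 1 <= 3 k]. *)
Lemma balanced_prob_lb (R : realFieldType) (k v : nat) (p : R) : (0 < k)%N -> (v.*2 <= k)%N ->
  'C(v.*2, v)%:R / 4 ^+ v <= p -> 1 <= p ^+ 2 * (3 * k)%:R.
Proof.
move=> k0 vk cp; apply: (@le_trans _ _ (('C(v.*2, v)%:R / 4 ^+ v) ^+ 2 * (3 * k)%:R)); last first.
  by rewrite ler_wpM2r // lerXn2r // nnegrE ?(le_trans _ cp) // divr_ge0 // exprn_ge0.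
rewrite expr_div_n -exprM mulnC exprM mulrAC ler_pdivlMr ?exprn_gt0 // ?exprn_gt0 // mul1r.
rewrite (_ : 4 ^+ 2 = 16%:R :> R); last by rewrite -natrX.
rewrite -!natrX -natrM ler_nat; apply: leq_trans (central_bin_lb v) _.
rewrite leq_mul2l; apply/orP; right; lia.
Qed.

Lemma card_split (T : finType) (Y : {set T}) (P Q : {set {set T}}) :
  (forall A, A \in P -> A \subset Y) -> (forall B, B \in Q -> B \subset ~: Y) ->
  #|[set L | (L :&: Y \in P) && (L :\: Y \in Q)]| = (#|P| * #|Q|)%N.
Proof.
move=> PY QY; pose f (L : {set T}) := (L :&: Y, L :\: Y).
have fI : injective f by move=> L L' [e1 e2]; rewrite -(setID L Y) e1 e2 setID.
rewrite -cardsX -(card_imset _ fI); apply: eq_card => -[A B].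
rewrite !inE /=; apply/imsetP/andP => [[L] |[AP BQ]].
  by rewrite inE => /andP[? ?] [-> ->].
have AY := PY _ AP; have BY := QY _ BQ.
have eA : (A :|: B) :&: Y = A.
  rewrite setIUl (setIidPl AY) (_ : B :&: Y = set0) ?setU0 //.
  by apply/eqP; rewrite setI_eq0 disjoints_subset.
have eB : (A :|: B) :\: Y = B.
  rewrite setDUl (_ : A :\: Y = set0) ?set0U; last by apply/eqP; rewrite setD_eq0.
  by rewrite setDE; apply/setIidPl.
by exists (A :|: B); rewrite ?inE ?eA ?eB ?AP ?BQ // /f eA eB.
Qed.

(** * Random half splits *)

Section Weighings.
Variable N : nat.
Notation X := {ffun 'I_N -> bool}.

Definition coins (x : X) : {set 'I_N} := [set i | x i].

Lemma card_coins x : #|coins x| = wt x.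
Proof. by apply: eq_card => i; rewrite !inE. Qed.

Lemma coins_inj : injective coins.
Proof. by move=> x y /setP E; apply/ffunP => i; have := E i; rewrite !inE. Qed.

Lemma sum_mem (R : pzRingType) (S : {set 'I_N}) : \sum_i (i \in S)%:R = #|S|%:R :> R.
Proof. by rewrite -sum1_card natr_sum [RHS]big_mkcond; apply: eq_bigr => i _; case: (i \in S). Qed.

Definition pans (A B : {set 'I_N}) : {ffun 'I_N -> 'I_3} :=
  [ffun i => if i \in A then inord 1 else if i \in B then inord 2 else ord0].

(* The null query when [A] and [B] have different sizes. *)
Definition weigh A B : QB N := insubd (null_query N) (pans A B).

Lemma chi_weigh x (A B : {set 'I_N}) : [disjoint A & B] ->
  chi x (weigh A B) =
  (#|A| == #|B|) && (#|A :&: coins x| != #|B :&: coins x|).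
Proof.
move=> dAB.
have nAB i : i \in A -> (i \in B) = false by move=> iA; rewrite (disjointFr dAB).
have pE : is_Bquery (pans A B) = (#|A| == #|B|).
  rewrite /is_Bquery; congr (_ == _); apply: eq_card => i; rewrite !inE ffunE /=.
    have [//|iA] := boolP (i \in A); first by rewrite inordK.
    by case: ifP => _; rewrite ?inordK.
  have [iA|iA] := boolP (i \in A); first by rewrite inordK // nAB.
  by have [iB|iB] := boolP (i \in B); rewrite ?inordK.
have [eAB|neAB] /= := eqVneq; last first.
  rewrite /weigh /insubd insubF ?chi_null // pE; exact: negbTE.
rewrite /chi (_ : \sum_i _ = #|A :&: coins x|%:R - #|B :&: coins x|%:R).
  by rewrite subr_eq0 eqr_nat.
rewrite -!sum_mem -sumrB; apply: eq_bigr => i _.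
rewrite -[sval _]/(val (weigh A B)) val_insubd pE eAB eqxx ffunE !inE /qval.
have [iA|iA] := boolP (i \in A).
  by rewrite /= inordK // nAB // mul1r subr0; case: (x i).
have [iB|iB] := boolP (i \in B).
  by rewrite /= inordK // sub0r mulN1r; case: (x i).
by rewrite mul0r subrr.
Qed.

Section Bias.
Variables (D M : finType) (q : {set D} -> M -> QB N) (supp : {set D} -> {set M}).

Lemma biasE x S : (0 < #|supp S|)%N ->
  bias q supp x S =
  2 * (#|[set m in supp S | ~~ chi x (q S m)]|%:R / #|supp S|%:R) - 1.
Proof.
move=> s0; have s0' : #|supp S|%:R != 0 :> rat by rewrite pnatr_eq0 -lt0n.
rewrite /bias (eq_bigr (fun m => 2 * (~~ chi x (q S m))%:R - 1)); last first.
  by move=> m _; case: chi.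
rewrite sumrB -mulr_sumr sumr_const.
have -> : \sum_(i in supp S) (~~ chi x (q S i))%:R
    = #|[set m in supp S | ~~ chi x (q S m)]|%:R :> rat.
  rewrite -sum1_card natr_sum [LHS]big_mkcond [RHS]big_mkcond; apply: eq_bigr => m _.
  by rewrite !inE; case: (m \in supp S); case: chi.
by field.
Qed.

Lemma bias_balanced x S : (0 < #|supp S|)%N ->
  (forall m, m \in supp S -> ~~ chi x (q S m)) -> bias q supp x S = 1.
Proof.
move=> s0 H; rewrite biasE // (_ : [set m in _ | _] = supp S).
  by rewrite divff ?pnatr_eq0 -?lt0n //; ring.
by apply/setP => m; rewrite !inE; case: (boolP (m \in _)) => //= /H ->.
Qed.

Lemma bias_tilted x S : (0 < #|supp S|)%N ->
  (forall m, m \in supp S -> chi x (q S m)) -> bias q supp x S = -1.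
Proof.
move=> s0 H; rewrite biasE // (_ : [set m in _ | _] = set0).
  by rewrite cards0 mul0r; ring.
by apply/setP => m; rewrite !inE; case: (boolP (m \in _)) => //= /H ->.
Qed.

End Bias.

(** If [#|S|] is odd the two parts differ in size, so [half_query] falls back on the null query and
    the bias is 1. *)
Definition half_supp (S : {set 'I_N}) : {set {set 'I_N}} :=
  [set L : {set 'I_N} | L \subset S & #|L| == #|S|./2].

Definition half_query (S L : {set 'I_N}) : QB N := weigh L (S :\: L).

Lemma card_half_supp S : #|half_supp S| = 'C(#|S|, #|S|./2).
Proof. exact: cards_draws. Qed.

Lemma half_supp_gt0 S : (0 < #|half_supp S|)%N.
Proof. by rewrite card_half_supp bin_gt0; lia. Qed.

Lemma chi_half x S L : L \in half_supp S -> chi x (half_query S L) =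
  ~~ odd #|S| && (#|L :&: coins x|.*2 != #|S :&: coins x|).
Proof.
rewrite inE => /andP[LS /eqP cL].
have dL : [disjoint L & S :\: L] by rewrite -setI_eq0; apply/eqP/setP => i; rewrite !inE; case: (i \in L); rewrite ?andbF.
rewrite /half_query chi_weigh // cardsD (setIidPr LS) cL.
have -> : (S :\: L) :&: coins x = (S :&: coins x) :\: (L :&: coins x).
  by apply/setP => i; rewrite !inE; case: (i \in L); case: (i \in S); case: (x i).
rewrite cardsD (setIidPr (setSI _ LS)).
have := subset_leq_card (setSI (coins x) LS); lia.
Qed.

(** For [w] false coins among [s] on the pans, the quotient is the hypergeometric probability that
    they split evenly. *)
Definition half_bias (w s : nat) : rat :=
  if odd s then 1 else if odd w then -1 else
  2 * ('C(w, w./2) * 'C(s - w, (s - w)./2))%:R / 'C(s, s./2)%:R - 1.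

Lemma bias_half x S :
  bias half_query half_supp x S = half_bias #|S :&: coins x| #|S|.
Proof.
have s0 := half_supp_gt0 S; rewrite /half_bias.
have [oS|eS] := boolP (odd #|S|).
  by apply: bias_balanced => // L /chi_half ->; rewrite oS.
have [oX|eX] := boolP (odd #|S :&: coins x|).
  by apply: bias_tilted => // L /chi_half ->; rewrite eS; apply: contraTneq oX => <-; rewrite odd_double.
rewrite biasE // card_half_supp mulrA; congr (2 * _%:R / _ - 1).
set Y := coins x; set w := #|_| in eX *.
have cS : (w + #|S :\: Y|)%N = #|S| := cardsID Y S.
have -> : (#|S| - w)%N = #|S :\: Y| by rewrite -cS addKn.
(* A balanced half of [S] consists of half of its false coins and half of its fair ones. *)
rewrite -!cards_draws -(card_split (Y := Y)); first last.
- by move=> B; rewrite inE => /andP[BS _]; apply: subset_trans BS _; rewrite setDE subsetIr.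
- by move=> A; rewrite inE => /andP[AS _]; apply: subset_trans AS _; rewrite subsetIr.
apply: eq_card => L; rewrite !inE; have [LS|LS] /= := boolP (L \subset S); last first.
  apply/esym/negbTE; apply: contra LS => /andP[/andP[L1 _] /andP[L2 _]].
  rewrite -(setID L Y) subUset (subset_trans L1) ?subsetIl //.
  by rewrite (subset_trans L2) ?subsetDl.
rewrite setSI // setSD //=.
have cL : (#|L :&: Y| + #|L :\: Y|)%N = #|L| := cardsID Y L.
have [eL|neL] /= := eqVneq #|L| _.
  rewrite chi_half ?inE ?LS ?eL ?eqxx // eS negbK -/Y -/w.
  rewrite eL -cS in cL; rewrite -cS in eS.
  move: #|L :&: Y| #|L :\: Y| #|S :\: Y| w cL eS eX {cS} => a b c d E1 E2 E3.
  apply/idP/andP => [/eqP E|[/eqP Ea /eqP Eb]]; [split|]; apply/eqP; lia.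
apply/esym/negbTE; apply: contraNN neL => /andP[/eqP Ea /eqP Eb].
rewrite -cS in eS; rewrite -cL -cS Ea Eb; apply/eqP.
move: w #|S :\: Y| eS eX {cS cL Ea Eb} => a b E1 E2; lia.
Qed.

(** Only [#|Y|] enters on the right, which is why the amplitude is the same for every string of
    weight [k]. *)
Lemma sum_by_split (Y : {set 'I_N}) (F : nat -> nat -> rat) :
  \sum_(S : {set 'I_N}) F #|S :&: Y| #|S :\: Y| =
  \sum_(a < N.+1) \sum_(b < N.+1) ('C(#|Y|, a) * 'C(N - #|Y|, b))%:R * F a b.
Proof.
have cY : (N - #|Y|)%N = #|~: Y| by rewrite [RHS]cardsCs setCK card_ord.
have le S : (#|S : {set 'I_N}| < N.+1)%N by rewrite ltnS -[X in (_ <= X)%N]card_ord max_card.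
transitivity (\sum_(S : {set 'I_N}) \sum_(a < N.+1) \sum_(b < N.+1)
  ((#|S :&: Y| == a) && (#|S :\: Y| == b))%:R * F a b).
  apply: eq_bigr => S _.
  rewrite (bigD1 (Ordinal (le (S :&: Y)))) //= [X in _ + X]big1 ?addr0.
    rewrite (bigD1 (Ordinal (le (S :\: Y)))) //= !eqxx mul1r big1 ?addr0 // => b /eqP nb.
    case: eqP => [e|]; rewrite ?mul0r //; case: nb; exact: val_inj.
  move=> a /eqP na; apply: big1 => b _.
  case: eqP => [e|]; rewrite /= ?mul0r //; case: na; exact: val_inj.
rewrite exchange_big; apply: eq_bigr => a _; rewrite exchange_big; apply: eq_bigr => b _ /=.
rewrite -mulr_suml; congr (_ * _).
rewrite cY -!cards_draws -(card_split (Y := Y)); first last.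
- by move=> B; rewrite inE => /andP[].
- by move=> A; rewrite inE => /andP[].
rewrite -sum1_card natr_sum [RHS]big_mkcond; apply: eq_bigr => S _.
rewrite !inE subsetIr setDE subsetIr /=; by case: (_ && _).
Qed.

End Weighings.

(** * Pair tests *)

Lemma odd_toggle (D : finType) (A : {set D}) i T :
  odd #|A :&: toggle i T| = (i \in A) (+) odd #|A :&: T|.
Proof. by apply: (@signr_inj int); rewrite signr_addb !signr_odd sign_toggle. Qed.

Lemma card_set_type (D : finType) : #|[set: {set D}]| = (2 ^ #|D|)%N.
Proof. by rewrite -powersetT card_powerset cardsT. Qed.

Lemma leq_bin_mul a b c d : ('C(a, c) * 'C(b, d) <= 'C(a + b, c + d))%N.
Proof.
by rewrite -binomial.Vandermonde (bigD1 (inord c)) //= inordK ?addKn ?leq_addr // ltnS leq_addr.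
Qed.

(** * Amplitude of the walk over half splits *)

Section HalfWalk.
Variables (N k T : nat).
Hypotheses (k_gt0 : (0 < k)%N) (kN : (2 * k < N)%N) (T_large : (1875 * k <= T ^ 4)%N).
Notation X := {ffun 'I_N -> bool}.

(** By [central_bin_ratio] the [m.*2] fair coins on the pans cannot push the probability below
    ['C(v.*2, v) / 4 ^ v]; this makes the bound free of [N]. *)
Lemma half_bias_even w s : (w <= s)%N -> (w <= k)%N -> ~~ odd w -> ~~ odd s ->
  exists p : rat, [/\ half_bias w s = 2 * p - 1, 0 <= p <= 1 & 1 <= p ^+ 2 * (3 * k)%:R].
Proof.
move=> ws wk ow os; rewrite /half_bias (negPf os) (negPf ow).
exists (('C(w, w./2) * 'C(s - w, (s - w)./2))%:R / 'C(s, s./2)%:R).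
have [v ev] : exists v, w = v.*2 by exists w./2; lia.
have [m em] : exists m, (s - w)%N = m.*2 by exists (s - w)./2; lia.
have es : s = (v + m).*2 by lia.
rewrite em ev es !doubleK.
have c0 : (0 < 'C((v + m).*2, v + m))%N by rewrite bin_gt0; lia.
have c0' : 0 < 'C((v + m).*2, v + m)%:R :> rat by rewrite ltr0n.
split; first by rewrite mulrA.
  rewrite divr_ge0 //= ler_pdivrMr // mul1r ler_nat doubleD; exact: leq_bin_mul.
apply: (balanced_prob_lb (v := v)) => //; first by rewrite -ev.
rewrite natrM -mulrA ler_wpM2l // ler_pdivlMr // mulrC ler_pdivrMr ?exprn_gt0 //.
by rewrite -natrX -natrM ler_nat mulnC central_bin_ratio.
Qed.

Lemma half_walk : exists2 t, (t < T)%N & exists2 a : rat, 1 / 5 <= `|a| &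
  forall x : X, wt x = k ->
    sample_amp (@half_query N) (@half_supp N) t x (coins x) = a.
Proof.
pose A : {set 'I_N} := [set i : 'I_N | (i < k)%N].
have cA : #|A| = k.
  have kN' : (k <= N)%N by lia.
  have wI : injective (widen_ord kN') by move=> a b e; apply: val_inj; exact: (congr1 val e).
  rewrite -[RHS]card_ord -(card_imset _ wI); apply: eq_card => i; rewrite inE; apply/idP/imsetP => [ik|[j _ ->]].
    by exists (Ordinal ik) => //; apply: val_inj.
  by rewrite /= ltn_ord.
have ik : (0 < N)%N by lia.
pose i : 'I_N := Ordinal ik; have iA : i \in A by rewrite inE.
have jk : (k < N)%N by lia.
pose j : 'I_N := Ordinal jk; have jA : j \in A = false by rewrite inE ltnn.
pose E := [pred S : {set 'I_N} | ~~ odd #|S|].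
pose z (S : {set 'I_N}) := half_bias #|S :&: A| #|S|.
(* Toggling one coin of [A] and one outside keeps the parity of the size and flips the sign, so the
   sums over even and over odd sets cancel separately. *)
pose h S := toggle i (toggle j S).
have hI : injective h by move=> S S' /(inv_inj (toggleK i))/(inv_inj (toggleK j)).
have hA S : (-1) ^+ #|A :&: h S| = - (-1) ^+ #|A :&: S| :> rat.
  by rewrite !sign_toggle iA jA mul1r mulN1r.
have hE S : odd #|h S| = odd #|S|.
  by rewrite -[h S]setTI !odd_toggle !in_setT setTI /= negbK.
have bal (P : pred {set 'I_N}) : (forall S, P (h S) = P S) ->
    \sum_(S | P S) (-1) ^+ #|A :&: S| = 0 :> rat.
  move=> hP; rewrite -[RHS](sum_sign0 (F := fun=> 1) hI hA hP) //.
  by apply: eq_bigr => S _; rewrite mulr1.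
have [||||| t tT tP] := @exists_walk_length _ A E z k T k_gt0 T_large.
- by move=> S /= eS oS; rewrite /z /half_bias (negPf eS) setIC oS.
- move=> S /= eS oS; rewrite setIC in oS; apply: half_bias_even => //.
    by rewrite subset_leq_card // subsetIl.
  by rewrite -cA subset_leq_card // subsetIr.
- by move=> S /= /negPn oS; rewrite /z /half_bias oS.
- by apply: bal => S; rewrite /= hE.
- by apply: bal => S; rewrite /= hE.
pose F w v : rat := (-1) ^+ w * cheb t (half_bias w (w + v)).
have sumF (Y : {set 'I_N}) : \sum_S (-1) ^+ #|Y :&: S| * cheb t (half_bias #|S :&: Y| #|S|)
    = \sum_S F #|S :&: Y| #|S :\: Y|.
  by apply: eq_bigr => S _; rewrite /F cardsID setIC.
exists t => //; exists ((\sum_S F #|S :&: A| #|S :\: A|) / 2 ^+ N).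
  rewrite normrM normfV [`|2 ^+ N|]ger0_norm ?exprn_ge0 // ler_pdivlMr ?exprn_gt0 //.
  rewrite -sumF; apply: le_trans tP.
  (* Exactly half of all sets have even size, which turns 2/5 of their number into 1/5 of
     [2 ^ N]. *)
  have : \sum_(S : {set 'I_N}) (-1) ^+ #|[set: 'I_N] :&: S| = 0 :> rat.
    rewrite -[RHS](sum_sign0 (A := setT) (P := predT) (F := fun=> 1) (inv_inj (toggleK i))) //.
      by apply: eq_bigr => S _; rewrite mulr1.
    by move=> S; rewrite sign_toggle inE mulN1r.
  have -> : \sum_(S : {set 'I_N}) (-1) ^+ #|[set: 'I_N] :&: S| =
      \sum_(S : {set 'I_N}) (2 * (E S)%:R - 1) :> rat.
    by apply: eq_bigr => S _; rewrite setTI -signr_odd /=; case: odd.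
  rewrite sumrB -mulr_sumr sumr_const -cardsT card_set_type card_ord natrX.
  have -> : \sum_(S : {set 'I_N}) (E S)%:R = #|[set S | E S]|%:R :> rat.
    by rewrite -sum1_card natr_sum [RHS]big_mkcond; apply: eq_bigr => S _; rewrite inE; case: (E S).
  lra.
move=> x wx; rewrite /sample_amp card_ord.
under eq_bigr do rewrite bias_half.
by rewrite sumF !sum_by_split cA card_coins wx.
Qed.
End HalfWalk.

Section PairTest.
Variables (N k : nat) (f g : 'I_k -> 'I_N).
Hypotheses (fI : injective f) (gI : injective g) (fg : forall i j, f i != g j).
Notation X := {ffun 'I_N -> bool}.

(** [L] is an orientation of the pairs: [pair_side L] lists the left coins and [pair_side (~: L)]
    their partners. *)
Definition pair_side (L : {set 'I_k}) i := if i \in L then f i else g i.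

Definition pair_query (I L : {set 'I_k}) : QB N :=
  weigh (pair_side L @: I) (pair_side (~: L) @: I).

Definition all_supp (I : {set 'I_k}) : {set {set 'I_k}} := setT.

Lemma pair_side_inj L : injective (pair_side L).
Proof.
move=> i j; rewrite /pair_side; case: ifP => _; case: ifP => _ //.
- exact: fI.
- by move/eqP; rewrite (negPf (fg _ _)).
- by move/esym/eqP; rewrite (negPf (fg _ _)).
- exact: gI.
Qed.

Lemma chi_pair (x : X) I L : chi x (pair_query I L) =
  (#|[set i in I | x (pair_side L i)]| != #|[set i in I | x (pair_side (~: L) i)]|).
Proof.
rewrite /pair_query chi_weigh.
  rewrite !card_imset ?eqxx //=; try exact: pair_side_inj.
  suff E L' : #|pair_side L' @: I :&: coins x| = #|[set i in I | x (pair_side L' i)]|.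
    by rewrite !E.
  rewrite -(card_imset (mem [set i in I | _]) (pair_side_inj (L := L'))).
  apply: eq_card => c; rewrite !inE; apply/andP/imsetP => [[/imsetP[i iI ->] xi]|[i]].
    by exists i; rewrite ?inE ?iI.
  by rewrite inE => /andP[iI xi] ->; rewrite imset_f.
rewrite -setI_eq0; apply/eqP/setP => c; rewrite !inE; apply/negP.
move=> /andP[/imsetP[i _ ->] /imsetP[j _]].
rewrite /pair_side inE; case: ifP => iL; case: ifP => jL /eqP //.
- by move/eqP/fI => ij; rewrite -ij iL in jL.
- by rewrite (negPf (fg _ _)).
- by rewrite eq_sym (negPf (fg _ _)).
- by move/eqP/gI => ij; rewrite -ij iL in jL.
Qed.

Lemma card_sift_toggle (P : pred 'I_k) i (I : {set 'I_k}) : i \notin I ->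
  #|[set j in toggle i I | P j]| = (P i + #|[set j in I | P j]|)%N.
Proof.
move=> iI; rewrite /toggle (negPf iI).
have [Pi|Pi] := boolP (P i).
  rewrite (_ : [set j in i |: I | P j] = i |: [set j in I | P j]).
    by rewrite cardsU1 inE (negPf iI).
  by apply/setP => j; rewrite !inE; have [->|] := eqVneq j i.
apply: eq_card => j; rewrite !inE.
by have [->|] := eqVneq j i; rewrite ?(negPf iI) //= (negPf Pi).
Qed.

(** A pair of equal coins adds the same weight to both pans. *)
Lemma chi_pair_toggle (x : X) i I L : x (f i) = x (g i) ->
  chi x (pair_query (toggle i I) L) = chi x (pair_query I L).
Proof.
move=> xi; wlog iI : I / i \notin I => [H|].
  have [iI|/H //] := boolP (i \in I).
  by rewrite -[in RHS](toggleK i I) (H (toggle i I)) ?toggle_in ?eqxx ?iI // toggleK.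
rewrite !chi_pair !card_sift_toggle //.
have -> : x (pair_side (~: L) i) = x (pair_side L i).
  by rewrite /pair_side inE; case: (i \in L).
by rewrite eqn_add2l.
Qed.

(** Toggling the like pair [i] preserves the bias and flips the sign, so the terms cancel. *)
Lemma pair_amp0 t (x : X) i : x (f i) = x (g i) -> sample_amp pair_query all_supp t x setT = 0.
Proof.
move=> xi; rewrite /sample_amp.
rewrite (sum_sign0 (P := predT) (inv_inj (toggleK i))) ?mul0r //.
  by move=> I; rewrite sign_toggle inE mulN1r.
move=> I; congr (cheb _ (_ / _)).
by apply: eq_bigr => L _; rewrite chi_pair_toggle.
Qed.

(** The quotient is the probability that [u] independent random orientations of unlike pairs
    balance. *)
Definition pair_bias u : rat :=
  if odd u then -1 else 2 * ('C(u, u./2)%:R / 2 ^+ u) - 1.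

Lemma bias_pair (x : X) I : (forall i, x (f i)) -> (forall i, ~~ x (g i)) ->
  bias pair_query all_supp x I = pair_bias #|I|.
Proof.
move=> xf xg; have s0 : (0 < #|all_supp I|)%N by rewrite card_set_type expn_gt0.
have chiE L : chi x (pair_query I L) = (#|L :&: I|.*2 != #|I|).
  rewrite chi_pair.
  have -> : [set i in I | x (pair_side L i)] = L :&: I.
    by apply/setP => i; rewrite !inE /pair_side; case: ifP; rewrite ?xf ?(negPf (xg _)) ?andbT ?andbF.
  have -> : [set i in I | x (pair_side (~: L) i)] = I :\: L.
    by apply/setP => i; rewrite !inE /pair_side inE; case: ifP => //=; rewrite ?xf ?(negPf (xg _)) ?andbT ?andbF.
  by have := cardsID L I; rewrite setIC; lia.
rewrite /pair_bias; have [oI|eI] := boolP (odd #|I|).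
  by apply: bias_tilted => // L _; rewrite chiE; apply: contraTneq oI => <-; rewrite odd_double.
rewrite biasE // card_set_type card_ord; congr (2 * _ - 1).
(* Half of the pairs in [I] are oriented one way; the pairs outside [I] are free. *)
have -> : #|[set L in all_supp I | ~~ chi x (pair_query I L)]| =
    ('C(#|I|, #|I|./2) * 2 ^ (k - #|I|))%N.
  have -> : (k - #|I|)%N = #|~: I| by rewrite [RHS]cardsCs setCK card_ord.
  rewrite -cards_draws -card_powerset -(card_split (Y := I)); first last.
  - by move=> B; rewrite inE.
  - by move=> A; rewrite inE => /andP[].
  apply: eq_card => L; rewrite !inE chiE negbK subsetIr setDE subsetIr /= andbT; lia.
have uk : (#|I| <= k)%N by rewrite -[X in (_ <= X)%N]card_ord max_card.
have e2 : 2 ^+ k = 2 ^+ (k - #|I|) * 2 ^+ #|I| :> rat by rewrite -exprD subnK.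
rewrite natrM !natrX e2.
by field; rewrite !expf_neq0.
Qed.

Lemma pair_amp1 t (x : X) : (forall i, x (f i)) -> (forall i, ~~ x (g i)) ->
  sample_amp pair_query all_supp t x setT =
  (\sum_(I : {set 'I_k}) (-1) ^+ #|I| * cheb t (pair_bias #|I|)) / 2 ^+ k.
Proof.
move=> xf xg; rewrite /sample_amp card_ord; congr (_ / _).
by apply: eq_bigr => I _; rewrite setTI bias_pair.
Qed.
End PairTest.

(** Every set of pairs loads the pans equally, so [E] is everything and the full 2/5 survives. *)
Lemma pair_walk (k T : nat) : (0 < k)%N -> (1875 * k <= T ^ 4)%N ->
  exists2 t, (t < T)%N & 2 / 5 <=
    `|(\sum_(I : {set 'I_k}) (-1) ^+ #|I| * cheb t (pair_bias #|I|)) / 2 ^+ k|.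
Proof.
move=> k0 Tk.
have bal : \sum_(S : {set 'I_k}) (-1) ^+ #|[set: 'I_k] :&: S| = 0 :> rat.
  rewrite -[RHS](sum_sign0 (A := setT) (P := predT) (F := fun=> 1) (inv_inj (toggleK (Ordinal k0)))) //.
    by apply: eq_bigr => S _; rewrite mulr1.
  by move=> S; rewrite sign_toggle inE mulN1r.
have [||||| t tT tP] := @exists_walk_length _ setT predT (fun S : {set 'I_k} => pair_bias #|S|) k T k0 Tk.
- by move=> S _; rewrite setTI /pair_bias => ->.
- move=> S _; rewrite setTI /pair_bias => eS; rewrite (negPf eS); eexists; split; first by [].
    rewrite divr_ge0 ?exprn_ge0 //= ler_pdivrMr ?exprn_gt0 // mul1r -natrX ler_nat.
    by rewrite -[in X in (_ <= X)%N](card_powerset S) -cards_draws subset_leq_card //; apply/subsetP => L; rewrite !inE => /andP[].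
  have es : #|S| = #|S|./2.*2 by lia.
  apply: (balanced_prob_lb (v := #|S|./2)) => //.
    by rewrite -es -[X in (_ <= X)%N]card_ord max_card.
  by rewrite -es (_ : 2 ^+ #|S| = 4 ^+ #|S|./2) // {1}es -mul2n exprM.
- by [].
- by [].
- by rewrite big_pred0.
exists t => //.
rewrite normrM normfV [`|2 ^+ k|]ger0_norm ?exprn_ge0 // ler_pdivlMr ?exprn_gt0 //.
apply: le_trans (le_trans tP _).
  by rewrite (_ : [set S | predT S] = setT) ?card_set_type ?card_ord ?natrX //; apply/setP => S; rewrite !inE.
by rewrite le_eqVlt; apply/orP; left; apply/eqP; congr `|_|; apply: eq_bigr => S _; rewrite setTI.
Qed.

(** * Exact search *)

(** Combines one half walk with two pair tests; 4/125 is rounded down to 1/40. *)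
Lemma norm_prod_ge (R : realFieldType) (a b : R) :
  1 / 5 <= `|a| -> 2 / 5 <= `|b| -> `|1 / 40 : R| <= `|a * b * b|.
Proof.
move=> a5 b5; rewrite [`|a * b * b|]normrM [`|a * b|]normrM [`|1 / 40|]ger0_norm; last by lra.
have ab : 1 / 5 * (2 / 5) <= `|a| * `|b| by apply: ler_pM => //; lra.
apply: (@le_trans _ _ (1 / 5 * (2 / 5) * (2 / 5))); first by lra.
by apply: ler_pM => //; lra.
Qed.

(* One round triples the amplitude up to a cubic loss; from 1/40 four rounds
   suffice when each is tuned down to a rational value, the last but one to
   [sin (pi / 6) = 1 / 2]. *)
Lemma amplify_chain (R : realFieldType) (h := fun b : R => 3 * b - 4 * b ^+ 3) :
  [/\ `|7 / 100| <= `|h (1 / 40)|, `|7 / 40| <= `|h (7 / 100)|,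
      `|1 / 2| <= `|h (7 / 40)| & `|1| <= `|h (1 / 2)|].
Proof.
have H (u v : R) : 0 <= v -> v <= h u -> `|v| <= `|h u|.
  by move=> v0 vu; rewrite !ger0_norm // (le_trans v0).
by rewrite /h; split; apply: H; rewrite /h; lra.
Qed.

Section Search.
Variables (K : numClosedFieldType) (N k : nat).
Notation X := {ffun 'I_N -> bool}.
Notation O := {o : X | wt o == k}.
Notation amplitudes := (@amplitudes K N).
Notation test_amplitudes := (@test_amplitudes K N).

(** The value [a] is the same for all [x], as exact amplification requires. *)
Definition finds n (a : rat) := exists alpha : X -> O -> K,
  amplitudes n alpha /\
  forall x o, wt x = k -> alpha x o = ratr (if val o == x then a else 0).

(** The constant test [b / a] does it; if [a = 0] then [b = 0], and the default value 0 of the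
    quotient is right. *)
Lemma finds_scale n a b : `|b| <= `|a| -> finds n a -> finds n b.
Proof.
move=> ba [alpha [aI aE]]; exists (fun x o => alpha x o * ratr (b / a)); split.
  rewrite -[n]addn0; apply: amplitudes_mul aI _.
  apply: test_amplitudes_const; rewrite -(rmorphN1 (@ratr K)) -(rmorph1 (@ratr K)) !ler_rat.
  rewrite -ler_norml normrM normfV.
  by have [->|a0] := eqVneq a 0; rewrite ?normr0 ?invr0 ?mulr0 // ler_pdivrMr ?normr_gt0 ?mul1r.
move=> x o wx; rewrite aE // -rmorphM; congr ratr.
case: ifP => _; last by rewrite mul0r.
have [a0|a0] := eqVneq a 0; last by field.
by move: ba; rewrite a0 normr0 normr_le0 => /eqP ->; rewrite mul0r.
Qed.

(** Only the correct outcome contributes to the total probability, so this is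
    [sin (3 x) = 3 sin x - 4 sin^3 x]. *)
Lemma finds_amplify n a : finds n a -> finds (3 * n) (3 * a - 4 * a ^+ 3).
Proof.
move=> [alpha [aI aE]]; eexists; split; first exact: amplitudes_amplify aI.
move=> x o wx /=.
have xP : wt x == k by apply/eqP.
rewrite (bigD1 (exist _ x xP)) //= big1 => [|o' ne]; last first.
  rewrite aE // ifF ?rmorph0 ?normr0 ?expr0n //.
  by apply: contraNF ne => /eqP e; apply/eqP/val_inj.
rewrite !aE //= eqxx addr0 -ratr_norm -rmorphXn /= real_normK ?num_real //.
rewrite -(ratr_nat K 3) -(ratr_nat K 4) -!(rmorphM, rmorphB) /=; congr ratr.
case: ifP => _; ring.
Qed.

Lemma pair_tests t (f g : O -> 'I_k -> 'I_N) :
  test_amplitudes t (fun o x =>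
    ratr (sample_amp (pair_query (f o) (g o)) (@all_supp k) t x setT)).
Proof.
have s0 I : (0 < #|all_supp (k := k) I|)%N by rewrite card_set_type expn_gt0.
have /fin_all_exists[F FP] o := sampler K (pair_query (f o) (g o)) (null_query N) set0 s0 t.
exists ({set 'I_k} * {set 'I_k})%type, (null_query N, (set0, set0)),
  (null_query N, (set0, setT)), F; split=> [o|o x]; first by have [] := FP o.
by have [_ ->] := FP o.
Qed.

(** Consecutive [h i] both differ from the same [f i], so all [k + 1] of them agree. They cannot all
    be false, hence all are fair and all [f i] are false. *)
Lemma pairing_certificate (x : X) (o : O) (f : 'I_k -> 'I_N) (h : 'I_k.+1 -> 'I_N) :
  (2 * k < N)%N -> injective f -> injective h ->
  (forall i, val o (f i)) -> (forall i, ~~ val o (h i)) -> wt x = k ->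
  (forall i, x (f i) != x (h (widen_ord (leqnSn k) i))) ->
  (forall i, x (f i) != x (h (lift ord0 i))) -> val o = x.
Proof.
move=> kN fI hI fo ho wx ne1 ne2.
have hh (i : 'I_k.+1) : x (h i) = x (h ord0).
  case: i => i; elim: i => [|i IH] ik; first by congr (x (h _)); apply: val_inj.
  rewrite -(IH (ltnW ik)).
  have := ne1 (Ordinal (ik : (i < k)%N)); have := ne2 (Ordinal (ik : (i < k)%N)).
  rewrite [lift _ _](_ : _ = Ordinal ik); last exact: val_inj.
  rewrite [widen_ord _ _](_ : _ = Ordinal (ltnW ik)); last exact: val_inj.
  by do 3 case: (x _).
have h0 : x (h ord0) = false.
  apply/negbTE/negP => hT.
  have : (#|h @: setT| <= #|coins x|)%N.
    apply/subset_leq_card/subsetP => c /imsetP[i _ ->]; rewrite inE hh; exact: hT.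
  by rewrite card_imset // cardsT card_ord card_coins wx ltnn.
have fx i : x (f i) by have := ne1 i; rewrite hh h0; case: (x _).
have cf : #|f @: setT| = k by rewrite card_imset // cardsT card_ord.
have eo : f @: setT = coins (val o).
  apply/eqP; rewrite eqEcard cf card_coins (eqP (valP o)) leqnn andbT.
  by apply/subsetP => c /imsetP[i _ ->]; rewrite inE.
apply: coins_inj; rewrite -eo; apply/eqP; rewrite eqEcard cf card_coins wx leqnn andbT.
by apply/subsetP => c /imsetP[i _ ->]; rewrite inE.
Qed.

(** The [k + 1] supposedly fair coins exist because [N - k >= k + 1]. *)
Lemma pairing_enum (o : O) : (2 * k < N)%N ->
  exists fh : ('I_k -> 'I_N) * ('I_k.+1 -> 'I_N),
    [/\ injective fh.1, injective fh.2, forall i, val o (fh.1 i) & forall i, ~~ val o (fh.2 i)].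
Proof.
move=> kN.
have emb (m : nat) (Y : {set 'I_N}) : (m <= #|Y|)%N ->
    exists2 e : 'I_m -> 'I_N, injective e & forall i, e i \in Y.
  move=> mY; exists (fun i => enum_val (widen_ord mY i)) => [i j /enum_val_inj e|i].
    by apply: val_inj; exact: (congr1 val e).
  exact: enum_valP.
have co : #|coins (val o)| = k by rewrite card_coins; apply/eqP; exact: (valP o).
have [|f fI fo] := emb k (coins (val o)); first by rewrite co.
have [|h hI ho] := emb k.+1 (~: coins (val o)); first by rewrite cardsCs setCK card_ord co; lia.
exists (f, h); split=> //= i; first by have := fo i; rewrite inE.
by have := ho i; rewrite !inE.
Qed.

Lemma finds_weakly T : (0 < k)%N -> (2 * k < N)%N -> (1875 * k <= T ^ 4)%N ->
  exists n, (n <= 3 * T)%N /\ finds n (1 / 40).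
Proof.
move=> k0 kN Tk.
have [t tT [a a5 aE]] := half_walk k0 kN Tk.
have [u uT] := pair_walk k0 Tk; set b := (X in `|X|) => b5.
have /fin_all_exists[fh fhP] o := pairing_enum o kN.
pose f o := (fh o).1; pose h o := (fh o).2.
(* The matchings join candidate coin [i] to supposedly fair coins [i] and [i + 1]. *)
pose g1 o i := h o (widen_ord (leqnSn k) i); pose g2 o i := h o (lift ord0 i).
have g1I o : injective (g1 o).
  have [_ hI _ _] := fhP o; move=> i j /hI e; apply: val_inj; exact: (congr1 val e).
have g2I o : injective (g2 o) by have [_ hI _ _] := fhP o; move=> i j /hI /lift_inj.
have fg1 o i j : f o i != g1 o j.
  by have [_ _ fo ho] := fhP o; apply: contraTneq (fo i) => e; rewrite -[_ i]/(f o i) e; apply: ho.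
have fg2 o i j : f o i != g2 o j.
  by have [_ _ fo ho] := fhP o; apply: contraTneq (fo i) => e; rewrite -[_ i]/(f o i) e; apply: ho.
have half0 : amplitudes t (fun x (o : O) =>
    ratr (sample_amp (@half_query N) (@half_supp N) t x (coins (val o)))).
  have [F [FI FE]] := sampler K (@half_query N) (null_query N) set0 (@half_supp_gt0 N) t.
  exists ({set 'I_N} * {set 'I_N})%type, (null_query N, (set0, set0)),
    (fun o => (null_query N, (set0, coins (val o)))), F; split=> //.
  - by move=> o o' [] /coins_inj /val_inj.
  - by move=> x o; apply: FE.
exists (t + u + u)%N; split; first by lia.
apply: (@finds_scale _ (a * b * b)).
  exact: norm_prod_ge.
eexists; split.
  exact: amplitudes_mul (amplitudes_mul half0 (pair_tests u f g1)) (pair_tests u f g2).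
move=> x o wx /=; rewrite -!rmorphM; congr ratr.
have [fI hI fo ho] := fhP o.
case: eqP => [ox|nox].
  rewrite ox aE // !pair_amp1 //;
    by move=> i; rewrite -ox; first [exact: fo | exact: ho].
(* A wrong candidate has a like pair in one of the matchings, and that factor vanishes. *)
have [/existsP[i /eqP xi]|/existsPn n1] := boolP [exists i, x (f o i) == x (g1 o i)].
  by rewrite (pair_amp0 fI (g1I o) (fg1 o) u xi) mulr0 mul0r.
have [/existsP[i /eqP xi]|/existsPn n2] := boolP [exists i, x (f o i) == x (g2 o i)].
  by rewrite (pair_amp0 fI (g2I o) (fg2 o) u xi) mulr0.
by case: nox; apply: (pairing_certificate kN fI hI).
Qed.

(** Four rounds, each tripling the queries. *)
Lemma finds_exactly n : finds n (1 / 40) -> finds (81 * n) 1.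
Proof.
rewrite -[81%N]/(3 * (3 * (3 * 3)))%N -!mulnA => F.
have [c1 c2 c3 c4] := amplify_chain rat.
apply: finds_scale c4 (finds_amplify _); apply: finds_scale c3 (finds_amplify _).
by apply: finds_scale c2 (finds_amplify _); apply: finds_scale c1 (finds_amplify _).
Qed.

(** The least admissible [T] satisfies [T <= 2 (T - 1)], whence the factor [16 = 2^4]. *)
Lemma query_count : (0 < k)%N -> exists T, (1875 * k <= T ^ 4)%N /\ (T ^ 4 <= 16 * (1875 * k))%N.
Proof.
move=> k0; have ex : exists T, (1875 * k <= T ^ 4)%N.
  by exists (1875 * k)%N; rewrite -[X in (X <= _)%N]expn1 leq_pexp2l //; lia.
exists (ex_minn ex); case: ex_minnP => T Tk Tmin; split=> //.
have T2 : (2 <= T)%N by case: T Tk {Tmin} => [|[|]] //; lia.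
have : (T.-1 ^ 4 < 1875 * k)%N by rewrite ltnNge; apply/negP => /Tmin; lia.
have : (T ^ 4 <= (2 * T.-1) ^ 4)%N by rewrite leq_exp2r //; lia.
rewrite expnMn; lia.
Qed.

End Search.

(** * The algorithm *)

Section MatrixOf.
Variables (K : numClosedFieldType) (S : finType) (f g : (S -> K) -> S -> K).
Hypothesis fU : unit_map f g.

Definition matrix_of (s t : S) : K := f (ket K t) s.

Lemma matrix_of_unitary s t : \sum_r (matrix_of r s)^* * matrix_of r t = (s == t)%:R.
Proof. by have [_ fI _ _] := fU; rewrite -/(ip _ _) fI ip_ketl. Qed.

(** Row [s] of the matrix is the conjugate of [g (ket K s)], so the sum is an inner product moved
    across the adjoint. *)
Lemma matrix_ofE v s : \sum_t matrix_of s t * v t = f v s.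
Proof.
rewrite -[RHS]ip_ketl -[RHS]ipC -(unit_map_adj v (ket K s) fU) ipC.
apply: eq_bigr => t _; congr (_ * _).
by rewrite -[g _ t]ip_ketl (unit_map_adj _ _ fU) ip_ketr conjCK.
Qed.
End MatrixOf.

Section Measure.
Variables (K : numClosedFieldType) (S : finType).

(** An entry 1 exhausts the norm; this settles the basis states about which [amplitudes] says
    nothing. *)
Lemma sum_norm_concentrated (v : S -> K) (P : pred S) s :
  ip v v = 1 -> v s = 1 -> P s -> \sum_(t | P t) `|v t| ^+ 2 = 1.
Proof.
rewrite ip_norm (bigD1 s) //= => vv vs Ps; move: vv; rewrite vs normr1 expr1n.
move=> /(canRL (addKr 1)); rewrite addNr => v0.
rewrite (bigD1 s) //= vs normr1 expr1n big1 ?addr0 // => t /andP[_ ts].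
exact: (psumr_eq0P (fun i _ => exprn_ge0 2 (normr_ge0 (v i))) v0).
Qed.
End Measure.

Lemma qalg_of_finds (N k n : nat) : finds C N k n 1 ->
  exists A : qalg N, nqueries A = n /\
    forall x : {ffun 'I_N -> bool}, wt x = k -> prob_output A x x = 1.
Proof.
move=> [alpha [[W [s0 [out [F [outI FI FE]]]]] aE]].
have [gs [gs' [gU gE]]] := FI.
(* Basis states designating no candidate output the zero string by default; on inputs of weight [k]
   they end with amplitude 0. *)
pose o2x s := if [pick o | out o == s] is Some o then val o else [ffun=> false].
pose A := @QAlg N W n s0 (fun i => matrix_of (gs i))
  (fun i _ s t => matrix_of_unitary (gU i) s t) o2x.
exists A; split=> // x wx.
have stE i : state A x i = run gs x i (ket C s0).
  elim: i => [|i IH]; apply: functional_extensionality => s.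
    exact: (matrix_ofE (gU 0)).
  by rewrite [state _ _ _]/= IH; apply: (matrix_ofE (gU i.+1)).
rewrite /prob_output /final_state stE -gE.
have xP : wt x == k by apply/eqP.
apply: (@sum_norm_concentrated C _ _ _ (out (exist _ x xP))).
- have [F' [_ /(_ x) [_ -> _ _]]] := impl_inv FI.
  by rewrite ip_ketl /ket eqxx.
- by rewrite FE aE //= eqxx rmorph1.
rewrite /= /o2x; case: pickP => [o /eqP/outI -> //|/(_ (exist _ x xP))].
by rewrite eqxx.
Qed.

Lemma leq_pow4 d m n T k : (n <= d * T)%N -> (T ^ 4 <= m * k)%N ->
  (n ^ 4 <= d ^ 4 * m * k)%N.
Proof.
move=> nT Tk; apply: (@leq_trans ((d * T) ^ 4)); first by rewrite leq_exp2r.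
by rewrite expnMn -mulnA leq_mul2l Tk orbT.
Qed.

(* Query bound O(k^{1/4}) with absolute constant, written as T^4 <= c * k. *)
Theorem theorem1 :
  exists c : nat, forall N k : nat, (1 <= k)%N -> (2 * k < N)%N ->
    exists A : qalg N,
      (nqueries A ^ 4 <= c * k)%N /\
      forall x : {ffun 'I_N -> bool}, wt x = k -> prob_output A x x = 1.
Proof.
(* At most [81 * 3 = 243] times [T] queries are made, and [T ^ 4 <= 16 * 1875 * k]. *)
exists (243 ^ 4 * (16 * 1875))%N => N k k0 kN.
have [T [Tk Tk']] := query_count k0.
have [n [nT nF]] := finds_weakly C k0 kN Tk.
have [A [An AE]] := qalg_of_finds (finds_exactly nF).
exists A; split; last exact: AE.
rewrite An; apply: (leq_pow4 (T := T)).
  by rewrite (_ : 243 = 81 * 3)%N // -mulnA leq_mul2l nT orbT.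
by rewrite -mulnA.
Qed.
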